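(* Let $R$ and $S$ be left Noetherian rings that are derived equivalent. Then $R$ satisfies the Generalized Auslander-Reiten Conjecture if and only if $S$ does.
   Context: For a left Noetherian ring $R$, $R\text{-mod}$ is the category of finitely generated left $R$-modules and $\mathsf{D}^b(R\text{-mod})$ is its bounded derived category. Two rings $R$ and $S$ are derived equivalent if there exists an equivalence of triangulated categories between $\mathsf{D}^b(R\text{-mod})$ and $\mathsf{D}^b(S\text{-mod})$. A left Noetherian ring $R$ satisfies the Generalized Auslander-Reiten Conjecture if the following holds for every finitely generated left $R$-module $M$: if there is an integer $n$ with $\operatorname{Ext}_R^i(M,M)=0=\operatorname{Ext}_R^i(M,R)$ for all $i\geq n$, then $M$ has finite projective dimension. *)

(* Defs.v *)
From HB Require Import structures.
From mathcomp Require Import all_boot all_order all_algebra.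
From mathcomp Require Import zify.
Set Implicit Arguments. Unset Strict Implicit. Unset Printing Implicit Defensive.
Import GRing.Theory.
Local Open Scope ring_scope.

(* Rings are [pzRingType] (associative, unital, possibly zero) and left modules
   are [lmodType R]. *)

Definition is_left_ideal (R : pzRingType) (I : R -> Prop) : Prop :=
  [/\ I 0, (forall x y, I x -> I y -> I (x + y)) & (forall a x, I x -> I (a * x))].

Definition left_noetherian (R : pzRingType) : Prop :=
  forall I : R -> Prop, is_left_ideal I ->
  exists (n : nat) (g : 'I_n -> R),
    (forall i, I (g i)) /\
    (forall x, I x -> exists c : 'I_n -> R, x = \sum_i c i * g i).

Definition fin_gen (R : pzRingType) (M : lmodType R) : Prop :=
  exists (n : nat) (g : 'I_n -> M),
    forall x : M, exists c : 'I_n -> R, x = \sum_i c i *: g i.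

Definition projective (R : pzRingType) (P : lmodType R) : Prop :=
  forall (U V : lmodType R) (p : {linear U -> V}) (f : {linear P -> V}),
    (forall v, exists u, p u = v) ->
    exists g : {linear P -> U}, forall x, p (g x) = f x.

Record proj_resolution (R : pzRingType) (M : lmodType R) := ProjResolution {
  pr_mod :> nat -> lmodType R;
  pr_diff : forall n, {linear pr_mod n.+1 -> pr_mod n};
  pr_aug : {linear pr_mod 0%N -> M};
  pr_proj : forall n, projective (pr_mod n);
  pr_aug_surj : forall m, exists x, pr_aug x = m;
  pr_exact0 : forall x, pr_aug x = 0 <-> exists y, pr_diff 0%N y = x;
  pr_exact : forall n x, pr_diff n x = 0 <-> exists y, pr_diff n.+1 y = x
}.

(* Cocycles and coboundaries of the cochain complex Hom_R(P_*, N). *)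
Definition ext_cocycle (R : pzRingType) (M N : lmodType R)
    (P : proj_resolution M) (i : nat) (f : {linear P i -> N}) : Prop :=
  forall y, f (pr_diff P i y) = 0.

Definition ext_coboundary (R : pzRingType) (M N : lmodType R)
    (P : proj_resolution M) (i : nat) : {linear P i -> N} -> Prop :=
  match i with
  | 0%N => fun f => forall x, f x = 0
  | j.+1 => fun f => exists g : {linear P j -> N}, forall x, f x = g (pr_diff P j x)
  end.

(* Ext^i_R(M, N) = 0, where Ext^i_R(M, N) = H^i(Hom_R(P_*, N)); the choice of
   the projective resolution P_* of M does not matter. *)
Definition ext_vanishes (R : pzRingType) (i : nat) (M N : lmodType R) : Prop :=
  forall (P : proj_resolution M) (f : {linear P i -> N}),
    ext_cocycle f -> ext_coboundary f.

Definition finite_proj_dim (R : pzRingType) (M : lmodType R) : Prop :=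
  exists (P : proj_resolution M) (n : nat),
    forall i, (n < i)%N -> forall x : P i, x = 0.

(* Ext in negative degrees is zero, so only the degrees i : nat matter. *)
Definition generalized_auslander_reiten (R : pzRingType) : Prop :=
  forall M : lmodType R, fin_gen M ->
    (exists n : int, forall i : nat, n <= i%:Z ->
       ext_vanishes i M M /\ ext_vanishes i M (R^o : lmodType R)) ->
    finite_proj_dim M.

(* Equality of morphisms is the equivalence relation [heq], not Leibniz equality. *)

Record category := Category {
  obj :> Type;
  hom : obj -> obj -> Type;
  heq : forall X Y, hom X Y -> hom X Y -> Prop;
  idm : forall X, hom X X;
  comp : forall X Y Z, hom Y Z -> hom X Y -> hom X Z;
  heq_refl : forall X Y (f : hom X Y), heq f f;
  heq_sym : forall X Y (f g : hom X Y), heq f g -> heq g f;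
  heq_trans : forall X Y (f g h : hom X Y), heq f g -> heq g h -> heq f h;
  comp_heq : forall X Y Z (f f' : hom Y Z) (g g' : hom X Y),
    heq f f' -> heq g g' -> heq (comp f g) (comp f' g');
  comp_idl : forall X Y (f : hom X Y), heq (comp (idm Y) f) f;
  comp_idr : forall X Y (f : hom X Y), heq (comp f (idm X)) f;
  compA : forall X Y Z T (f : hom Z T) (g : hom Y Z) (h : hom X Y),
    heq (comp f (comp g h)) (comp (comp f g) h)
}.
Arguments idm {c} X.

Definition is_iso (C : category) (X Y : C) (f : hom X Y) : Prop :=
  exists g : hom Y X, heq (comp g f) (idm X) /\ heq (comp f g) (idm Y).

Record functor (C D : category) := Functor {
  fobj :> C -> D;
  fmap : forall X Y, hom X Y -> hom (fobj X) (fobj Y);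
  fmap_heq : forall X Y (f g : hom X Y), heq f g -> heq (fmap f) (fmap g);
  fmap_id : forall X, heq (fmap (idm X)) (idm (fobj X));
  fmap_comp : forall X Y Z (f : hom Y Z) (g : hom X Y),
    heq (fmap (comp f g)) (comp (fmap f) (fmap g))
}.

Definition functor_id (C : category) : functor C C.
Proof.
exists id (fun X Y => id) => //= *; exact: heq_refl.
Defined.

Definition functor_comp (C D E : category) (G : functor D E) (F : functor C D) :
  functor C E.
Proof.
exists (fun X => G (F X)) (fun X Y f => fmap G (fmap F f)).
- by move=> X Y f g fg; do 2!apply: fmap_heq.
- by move=> X; apply: heq_trans (fmap_id G _); apply: fmap_heq; apply: fmap_id.
- move=> X Y Z f g; apply: heq_trans (fmap_comp G _ _).
  by apply: fmap_heq; apply: fmap_comp.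
Defined.

Record nat_iso (C D : category) (F G : functor C D) := NatIso {
  nt :> forall X, hom (F X) (G X);
  nt_natural : forall X Y (f : hom X Y),
    heq (comp (fmap G f) (nt X)) (comp (nt Y) (fmap F f));
  nt_iso : forall X, is_iso (nt X)
}.

Definition is_equivalence (C D : category) (F : functor C D) : Prop :=
  exists G : functor D C,
    inhabited (nat_iso (functor_comp G F) (functor_id C)) /\
    inhabited (nat_iso (functor_comp F G) (functor_id D)).

(* The data of a triangulated category: a category, its shift functor and its
   class of distinguished triangles X -> Y -> Z -> X[1]. *)
Record tri_data := TriData {
  tri_cat :> category;
  tri_shift : functor tri_cat tri_cat;
  distinguished : forall X Y Z : tri_cat,
    hom X Y -> hom Y Z -> hom Z (tri_shift X) -> Prop
}.

Definition is_triangulated (C D : tri_data) (F : functor C D)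
    (phi : nat_iso (functor_comp F (tri_shift C)) (functor_comp (tri_shift D) F)) :
    Prop :=
  forall (X Y Z : C) (u : hom X Y) (v : hom Y Z) (w : hom Z (tri_shift C X)),
    distinguished u v w ->
    distinguished (fmap F u) (fmap F v)
      (comp (phi X : hom _ (tri_shift D (F X))) (fmap F w)).

(* Additivity of F is not required separately: an equivalence of categories
   preserves finite biproducts, so it is additive as soon as C and D are. *)
Definition tri_equivalent (C D : tri_data) : Prop :=
  exists (F : functor C D)
         (phi : nat_iso (functor_comp F (tri_shift C)) (functor_comp (tri_shift D) F)),
    is_triangulated phi /\ is_equivalence F.

Definition next (n : int) : int := n + 1.

Record bcomplex (R : pzRingType) := BComplex {
  cx :> int -> lmodType R;
  cx_d : forall n, {linear cx n -> cx (next n)};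
  cx_dd : forall n x, cx_d (next n) (cx_d n x) = 0;
  cx_fg : forall n, fin_gen (cx n);
  cx_bounded : exists N : nat, forall n : int, (N < `|n|)%N -> forall x : cx n, x = 0
}.

Record cmap (R : pzRingType) (X Y : bcomplex R) := CMap {
  cm :> forall n, {linear X n -> Y n};
  cm_d : forall n x, cm (next n) (cx_d X n x) = cx_d Y n (cm n x)
}.

(* f induces a bijection on H^(n + 1) for every integer n, i.e., on the
   cohomology in every degree. *)
Definition quasi_iso (R : pzRingType) (X Y : bcomplex R) (f : cmap X Y) : Prop :=
  forall n : int,
    (forall x : X (next n), cx_d X (next n) x = 0 ->
       (exists y, cx_d Y n y = f (next n) x) -> exists x', cx_d X n x' = x) /\
    (forall y : Y (next n), cx_d Y (next n) y = 0 ->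
       exists x : X (next n),
         cx_d X (next n) x = 0 /\ exists y', f (next n) x - y = cx_d Y n y').

Definition cmap_id (R : pzRingType) (X : bcomplex R) : cmap X X :=
  @CMap R X X (fun n => idfun) (fun n x => erefl).

Definition cmap_comp (R : pzRingType) (X Y Z : bcomplex R)
  (g : cmap Y Z) (f : cmap X Y) : cmap X Z.
Proof.
by exists (fun n => g n \o f n) => n x /=; rewrite !cm_d.
Defined.

(* The shift: X[1]^n = X^(n + 1), with differential -d. *)
Definition shift (R : pzRingType) (X : bcomplex R) : bcomplex R.
Proof.
exists (fun n => X (next n)) (fun n => \- cx_d X (next n)).
- by move=> n x /=; rewrite linearN cx_dd !oppr0.
- by move=> n; apply: cx_fg.
- case: (cx_bounded X) => N HN; exists N.+1 => n Nn; apply: HN.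
  by rewrite /next; lia.
Defined.

Definition cmap_shift (R : pzRingType) (X Y : bcomplex R) (f : cmap X Y) :
  cmap (shift X) (shift Y).
Proof.
by exists (fun n => f (next n)) => n x /=; rewrite linearN cm_d.
Defined.

(* The mapping cone: Cone(f)^n = X^(n + 1) (+) Y^n, with differential
   (x, y) |-> (- d x, f x + d y). *)
Section Cone.
Variables (R : pzRingType) (X Y : bcomplex R) (f : cmap X Y).

Definition cone_mod (n : int) : lmodType R := (X (next n) * Y n)%type.

Definition cone_d (n : int) (p : cone_mod n) : cone_mod (next n) :=
  (- cx_d X (next n) p.1, f (next n) p.1 + cx_d Y n p.2).

Lemma cone_d_linear n : linear (@cone_d n).
Proof.
move=> a [x y] [x' y']; rewrite /cone_d; congr pair => /=.
  by rewrite linearP opprD scalerN.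
by rewrite !linearP scalerDr addrACA.
Qed.
HB.instance Definition _ n :=
  GRing.isLinear.Build R (cone_mod n) (cone_mod (next n)) _ (@cone_d n)
    (@cone_d_linear n).

Definition cone : bcomplex R.
Proof.
exists cone_mod (fun n => @cone_d n).
- move=> n [x y]; rewrite /cone_d /=; congr pair => /=.
    by rewrite linearN cx_dd !oppr0.
  by rewrite linearN linearD cx_dd addr0 cm_d addNr.
- move=> n.
  have [n1 [g1 H1]] := cx_fg X (next n); have [n2 [g2 H2]] := cx_fg Y n.
  exists (n1 + n2)%N, (fun i => match split i with
    | inl j => (g1 j, 0) | inr j => (0, g2 j) end) => -[x y].
  have [c1 ->] := H1 x; have [c2 ->] := H2 y.
  exists (fun i => match split i with inl j => c1 j | inr j => c2 j end).
  rewrite big_split_ord /=.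
  have spl i : split (lshift n2 i) = inl i := unsplitK (inl i).
  have spr i : split (rshift n1 i) = inr i := unsplitK (inr i).
  under [X in _ = X + _]eq_bigr => i _ do rewrite spl.
  under [X in _ = _ + X]eq_bigr => i _ do rewrite spr.
  rewrite [LHS]surjective_pairing [RHS]surjective_pairing /=.
  rewrite !(raddf_sum fst) !(raddf_sum snd) /=; congr pair.
    by rewrite [X in _ + X]big1 ?addr0 // => i _; rewrite scaler0.
  by rewrite [X in X + _]big1 ?add0r // => i _; rewrite scaler0.
- have [N1 H1] := cx_bounded (shift X); have [N2 H2] := cx_bounded Y.
  exists (maxn N1 N2) => n; rewrite gtn_max => /andP[/H1 h1 /H2 h2] [x y].
  by rewrite (h1 x) (h2 y).
Defined.

Definition cone_inr (n : int) (y : Y n) : cone_mod n := (0, y).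

Lemma cone_inr_linear n : linear (@cone_inr n).
Proof. by move=> a y y'; congr pair; rewrite /= scaler0 addr0. Qed.
HB.instance Definition _ n :=
  GRing.isLinear.Build R (Y n) (cone_mod n) _ (@cone_inr n) (@cone_inr_linear n).

Definition cone_in : cmap Y cone.
Proof.
exists (fun n => @cone_inr n : {linear Y n -> cone_mod n}) => n y; congr pair => /=.
  by rewrite linear0 oppr0.
by rewrite linear0 add0r.
Defined.

Definition cone_out : cmap cone (shift X).
Proof. by exists (fun n => fst : {linear cone_mod n -> X (next n)}). Defined.

End Cone.

(* The localization of the category of bounded complexes of finitely generated
   modules at the quasi-isomorphisms: the morphisms are the composites of chain
   maps and formal inverses of quasi-isomorphisms, modulo the congruence
   generated by the relations of a localization. *)
Inductive zigzag (R : pzRingType) : bcomplex R -> bcomplex R -> Type :=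
| zz_map X Y (f : cmap X Y) : zigzag X Y
| zz_inv X Y (s : cmap X Y) (qs : quasi_iso s) : zigzag Y X
| zz_comp X Y Z (u : zigzag Y Z) (v : zigzag X Y) : zigzag X Z.

Inductive zz_eq (R : pzRingType) :
  forall X Y : bcomplex R, zigzag X Y -> zigzag X Y -> Prop :=
| zz_refl X Y (u : zigzag X Y) : zz_eq u u
| zz_sym X Y (u v : zigzag X Y) : zz_eq u v -> zz_eq v u
| zz_trans X Y (u v w : zigzag X Y) : zz_eq u v -> zz_eq v w -> zz_eq u w
| zz_comp_eq X Y Z (u u' : zigzag Y Z) (v v' : zigzag X Y) :
    zz_eq u u' -> zz_eq v v' -> zz_eq (zz_comp u v) (zz_comp u' v')
| zz_idl X Y (u : zigzag X Y) : zz_eq (zz_comp (zz_map (cmap_id Y)) u) u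
| zz_idr X Y (u : zigzag X Y) : zz_eq (zz_comp u (zz_map (cmap_id X))) u
| zz_assoc X Y Z T (u : zigzag Z T) (v : zigzag Y Z) (w : zigzag X Y) :
    zz_eq (zz_comp u (zz_comp v w)) (zz_comp (zz_comp u v) w)
| zz_map_ext X Y (f g : cmap X Y) :
    (forall n x, f n x = g n x) -> zz_eq (zz_map f) (zz_map g)
| zz_map_comp X Y Z (g : cmap Y Z) (f : cmap X Y) :
    zz_eq (zz_map (cmap_comp g f)) (zz_comp (zz_map g) (zz_map f))
| zz_inv_l X Y (s : cmap X Y) (qs : quasi_iso s) :
    zz_eq (zz_comp (zz_inv qs) (zz_map s)) (zz_map (cmap_id X))
| zz_inv_r X Y (s : cmap X Y) (qs : quasi_iso s) :
    zz_eq (zz_comp (zz_map s) (zz_inv qs)) (zz_map (cmap_id Y)).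

Definition Db_cat (R : pzRingType) : category :=
  {| obj := bcomplex R;
     hom := @zigzag R;
     heq := @zz_eq R;
     idm := fun X => zz_map (cmap_id X);
     comp := @zz_comp R;
     heq_refl := @zz_refl R;
     heq_sym := @zz_sym R;
     heq_trans := @zz_trans R;
     comp_heq := @zz_comp_eq R;
     comp_idl := @zz_idl R;
     comp_idr := @zz_idr R;
     compA := @zz_assoc R |}.

Lemma quasi_iso_shift (R : pzRingType) (X Y : bcomplex R) (s : cmap X Y) :
  quasi_iso s -> quasi_iso (cmap_shift s).
Proof.
move=> qs n; have [inj surj] := qs (next n); split=> /= [x dx [y dy]|y dy].
  have [||x' <-] := inj x; first by rewrite -[LHS]opprK dx oppr0.
    by exists (- y); rewrite linearN.
  by exists (- x'); rewrite linearN opprK.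
have [|x [dx [y' e]]] := surj y; first by rewrite -[LHS]opprK dy oppr0.
by exists x; rewrite dx oppr0; split=> //; exists (- y'); rewrite linearN opprK.
Qed.

Fixpoint zz_shift (R : pzRingType) (X Y : bcomplex R) (u : zigzag X Y) :
    zigzag (shift X) (shift Y) :=
  match u with
  | zz_map _ _ f => zz_map (cmap_shift f)
  | zz_inv _ _ _ qs => zz_inv (quasi_iso_shift qs)
  | zz_comp _ _ _ u v => zz_comp (zz_shift u) (zz_shift v)
  end.

Lemma zz_shift_id (R : pzRingType) (X : bcomplex R) :
  zz_eq (zz_shift (zz_map (cmap_id X))) (zz_map (cmap_id (shift X))).
Proof. exact: zz_map_ext. Qed.

Lemma zz_shift_eq (R : pzRingType) (X Y : bcomplex R) (u v : zigzag X Y) :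
  zz_eq u v -> zz_eq (zz_shift u) (zz_shift v).
Proof.
elim=> {X Y u v} /=.
- by move=> *; apply: zz_refl.
- by move=> X Y u v _; apply: zz_sym.
- by move=> X Y u v w _ uv _; apply: zz_trans.
- by move=> X Y Z u u' v v' _ uu' _; apply: zz_comp_eq.
- move=> X Y u; apply: zz_trans (zz_idl _).
  by apply: zz_comp_eq (zz_refl _); apply: zz_shift_id.
- move=> X Y u; apply: zz_trans (zz_idr _).
  by apply: zz_comp_eq (zz_refl _) _; apply: zz_shift_id.
- by move=> *; apply: zz_assoc.
- by move=> X Y f g fg; apply: zz_map_ext => n x; apply: fg.
- by move=> X Y Z g f; apply: zz_trans (zz_map_comp _ _); apply: zz_map_ext.
- move=> X Y s qs; apply: zz_trans (zz_inv_l _) _.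
  by apply: zz_sym; apply: zz_shift_id.
- move=> X Y s qs; apply: zz_trans (zz_inv_r _) _.
  by apply: zz_sym; apply: zz_shift_id.
Qed.

Definition Db_shift (R : pzRingType) : functor (Db_cat R) (Db_cat R) :=
  @Functor (Db_cat R) (Db_cat R) (@shift R) (@zz_shift R) (@zz_shift_eq R)
    (@zz_shift_id R) (fun X Y Z u v => zz_refl _).

(* The triangles isomorphic in the derived category to a standard triangle
   A -> B -> Cone(f) -> A[1]. *)
Definition Db_distinguished (R : pzRingType) (X Y Z : Db_cat R)
    (u : hom X Y) (v : hom Y Z) (w : hom Z (Db_shift R X)) : Prop :=
  exists (A B : bcomplex R) (f : cmap A B)
    (a : @hom (Db_cat R) A X) (b : @hom (Db_cat R) B Y)
    (c : @hom (Db_cat R) (cone f) Z),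
    [/\ is_iso a, is_iso b & is_iso c] /\
    [/\ heq (comp u a) (comp b (zz_map f)),
        heq (comp v b) (comp c (zz_map (cone_in f)))
      & heq (comp w c) (comp (fmap (Db_shift R) a) (zz_map (cone_out f)))].

Definition Db (R : pzRingType) : tri_data :=
  {| tri_cat := Db_cat R;
     tri_shift := Db_shift R;
     distinguished := @Db_distinguished R |}.

Definition derived_equivalent (R S : pzRingType) : Prop :=
  tri_equivalent (Db R) (Db S).

(* Main.v *)
(* Call X in D^b(R-mod) perfect if, for some N, Hom(X, Y[i]) = 0 for all i >= N and
   all Y with cohomology in degrees <= 0. Truncating a resolution of X by finitely
   generated projectives shows that a module is perfect iff it has finite
   projective dimension. An equivalence F preserves perfection because it moves
   D^{<= 0} by a bounded amount: with respect to the vanishing of Hom, D^{<= 0} is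
   the left orthogonal of the right orthogonal of the R[i], i >= 0, and F(R) is
   bounded. Now let M be an S-module with Ext^i(M, M) = Ext^i(M, S) = 0 for
   i >> 0, and let X correspond to M. The image of R is perfect, hence a bounded
   complex of finitely generated projectives, so Hom(X, R[i]) = 0 for i >> 0; also
   Hom(X, X[i]) = 0 for i >> 0. A far enough syzygy of X is then a module to which
   the conjecture for R applies; so X is perfect, and hence so is M.

   Hom in the localization is computed as homotopy classes of maps out of a
   resolution that is unbounded below. *)
From HB Require Import structures.
From mathcomp Require Import all_boot all_order all_algebra.
From mathcomp Require Import zify boolp.
(* Last, because [path.next] would shadow [Defs.next]. *)
Require Import Defs.
Set Implicit Arguments. Unset Strict Implicit. Unset Printing Implicit Defensive.
Import GRing.Theory Order.TTheory Num.Theory.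
Local Open Scope ring_scope.

(** * Modules *)

(** A resolution by finitely generated projectives need not be bounded below, so it is in general no
    object of [Db_cat]. It stays outside the category: zigzags act on homotopy classes of maps out
    of it, and its truncations [btrunc], which are objects, lead back from maps to morphisms. A
    truncation must be low enough for the complexes at hand to vanish below it, since only then do
    maps factor through it; many of the constants come from this.

    Of Hom only its vanishing is used, in the form that any two zigzags are equal: this makes sense
    in a bare category and avoids adding zigzags. Instead of long exact sequences there are
    degreewise constructions of homotopies, downward against exactness ([null_homotopic]) or upward
    against vanishing cohomology ([coh0_nullh]).

    Degrees are integers, and [next (n - 1)] is [n] only up to a proof. Notions are therefore
    indexed by the source of a differential, and the remaining transports are confined to a few
    tools such as [unnext], [dep_update] and [cast_lin]. *)

Section Linear.
Variable R : pzRingType.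
Implicit Types U V P : lmodType R.

Definition mklin U V (f : U -> V) (h : linear f) : {linear U -> V} :=
  HB.pack f (GRing.isLinear.Build R U V _ f h).

Lemma mklinE U V (f : U -> V) (h : linear f) x : mklin h x = f x.
Proof. by []. Qed.

Record submodule V := Submodule {
  smem :> V -> Prop;
  smem0 : smem 0;
  smemP : forall a x y, smem x -> smem y -> smem (a *: x + y) }.

Definition spred V (S : submodule V) : {pred V} := fun v => `[< S v >].

Lemma spred_closed V (S : submodule V) : submod_closed (spred S).
Proof.
split; first by apply/asboolP; apply: smem0.
by move=> a x y /asboolP Sx /asboolP Sy; apply/asboolP; apply: smemP.
Qed.
HB.instance Definition _ V (S : submodule V) :=
  GRing.isSubmodClosed.Build R V (spred S) (spred_closed S).

Record subm V (S : submodule V) := Subm { sv : V; svP : sv \in spred S }.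
HB.instance Definition _ V (S : submodule V) := [isSub for @sv V S].
HB.instance Definition _ V (S : submodule V) := [Choice of subm S by <:].
HB.instance Definition _ V (S : submodule V) :=
  [SubChoice_isSubLmodule of subm S by <:].

Definition sub_of V (S : submodule V) : lmodType R := subm S.


Lemma sub_val_linear V (S : submodule V) : linear (fun x : sub_of S => \val x : V).
Proof. by []. Qed.
Definition sub_val V (S : submodule V) : {linear sub_of S -> V} :=
  mklin (@sub_val_linear V S).

Lemma sub_valP V (S : submodule V) (x : sub_of S) : S (sub_val S x).
Proof. by case: x => x /= /asboolP. Qed.

Lemma sub_val_inj V (S : submodule V) : injective (sub_val S).
Proof. by move=> x y; apply: val_inj. Qed.

Lemma sub_val_mk V (S : submodule V) x : S x -> exists y, sub_val S y = x.
Proof. by move=> Sx; have h : x \in spred S by [apply/asboolP]; exists (Subm h). Qed.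

Lemma corestrict U V (S : submodule V) (f : {linear U -> V}) :
  (forall x, S (f x)) -> exists g : {linear U -> sub_of S}, forall x, sub_val S (g x) = f x.
Proof.
move=> Sf; have /choice [g gE] := fun x => sub_val_mk (Sf x).
suff h : linear g by exists (mklin h).
by move=> a x y; apply: (@sub_val_inj _ S); rewrite linearP !gE linearP.
Qed.

Lemma im_proof U V (f : {linear U -> V}) :
  (exists x, f x = 0) /\ forall a x y,
  (exists u, f u = x) -> (exists u, f u = y) -> exists u, f u = a *: x + y.
Proof.
split; first by exists 0; rewrite linear0.
by move=> a x y [u <-] [v <-]; exists (a *: u + v); rewrite linearP.
Qed.
Definition im U V (f : {linear U -> V}) : submodule V :=
  Submodule (proj1 (im_proof f)) (proj2 (im_proof f)).

(** [projective] speaks of surjections only; corestricting both maps to the image of [p] makes [p]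
    surjective. *)
Lemma proj_lift P U V (p : {linear U -> V}) (f : {linear P -> V}) :
  projective P -> (forall x, exists u, p u = f x) ->
  exists g : {linear P -> U}, forall x, p (g x) = f x.
Proof.
move=> Pp fp.
have [f' f'E] := @corestrict _ _ (im p) f fp.
have [p' p'E] := @corestrict _ _ (im p) p (fun u => ex_intro _ u erefl).
have [|g gE] := Pp _ _ p' f'.
  by move=> v; have [u uE] := sub_valP v; exists u; apply: sub_val_inj; rewrite p'E.
by exists g => x; rewrite -p'E gE f'E.
Qed.

Definition retract_of V' V :=
  exists (i : {linear V' -> V}) (r : {linear V -> V'}), forall x, r (i x) = x.

Lemma projective_retract V' V : retract_of V' V -> projective V -> projective V'.
Proof.
move=> [i [r ri]] Pp U W p f p_surj.
have [g gE] := Pp U W p (f \o r) p_surj.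
by exists (g \o i) => x /=; rewrite gE /= ri.
Qed.

Lemma projective_zero V : (forall x : V, x = 0) -> projective V.
Proof.
move=> V0 U W p f _; exists \0 => x /=.
by rewrite (V0 x) !linear0.
Qed.

Lemma projective_rV n : projective ('rV[R]_n : lmodType R).
Proof.
move=> U V p f p_surj.
have /choice [u uE] := fun i => p_surj (f (delta_mx 0 i)).
have h : linear (fun x : 'rV[R]_n => \sum_i x 0 i *: u i).
  move=> a x y; rewrite scaler_sumr -big_split /=; apply: eq_bigr => i _.
  by rewrite !mxE scalerDl scalerA.
exists (mklin h) => x; rewrite mklinE raddf_sum /= [in RHS](row_sum_delta x) raddf_sum /=.
by apply: eq_bigr => i _; rewrite !linearZ /= uE.
Qed.

Lemma projective_reg : projective (R^o : lmodType R).
Proof.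
move=> U V p f p_surj; have [u uE] := p_surj (f 1).
have h : linear (fun x : R^o => (x : R) *: u).
  by move=> a x y; rewrite scalerDl scalerA.
by exists (mklin h) => x; rewrite mklinE linearZ /= uE -linearZ /= /GRing.scale /= mulr1.
Qed.

Lemma fin_gen_rV n : fin_gen ('rV[R]_n : lmodType R).
Proof.
by exists n, (fun i => delta_mx 0 i) => x; exists (x 0); apply: row_sum_delta.
Qed.

Lemma fin_gen_surj U V (f : {linear U -> V}) :
  (forall v, exists u, f u = v) -> fin_gen U -> fin_gen V.
Proof.
move=> fs [n [g gU]]; exists n, (f \o g) => v.
have [u <-] := fs v; have [c ->] := gU u; exists c.
by rewrite linear_sum; apply: eq_bigr => i _; rewrite linearZ.
Qed.

Lemma fin_gen_rV_surj V : fin_gen V ->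
  exists n (f : {linear 'rV[R]_n -> V}), forall v, exists u, f u = v.
Proof.
move=> [n [g gV]]; exists n.
have h : linear (fun x : 'rV[R]_n => \sum_i x 0 i *: g i).
  move=> a x y; rewrite scaler_sumr -big_split /=; apply: eq_bigr => i _.
  by rewrite !mxE scalerDl scalerA.
exists (mklin h) => v; have [c ->] := gV v.
by exists (\row_i c i); apply: eq_bigr => i _; rewrite mxE.
Qed.

Lemma fin_gen_reg : fin_gen (R^o : lmodType R).
Proof.
exists 1%N, (fun=> 1) => x; exists (fun=> x).
by rewrite big_ord1 /GRing.scale /= mulr1.
Qed.

Lemma fin_gen_retract V' V : retract_of V' V -> fin_gen V -> fin_gen V'.
Proof. by move=> [i [r ri]]; apply: (@fin_gen_surj _ _ r) => v; exists (i v). Qed.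

Lemma fin_gen_im U V (f : {linear U -> V}) : fin_gen U -> fin_gen (sub_of (im f)).
Proof.
have [f' f'E] := @corestrict _ _ (im f) f (fun u => ex_intro _ u erefl).
apply: (@fin_gen_surj _ _ f') => v; have [u uE] := sub_valP v.
by exists u; apply: sub_val_inj; rewrite f'E.
Qed.

Lemma fin_gen_prod U V : fin_gen U -> fin_gen V -> fin_gen (U * V)%type.
Proof.
move=> /fin_gen_rV_surj [m [f fs]] /fin_gen_rV_surj [n [g gs]].
have h : linear (fun x : 'rV[R]_(m + n) => (f (lsubmx x), g (rsubmx x)) : (U * V)%type).
  by move=> a x y; rewrite !linearP.
apply: (@fin_gen_surj _ _ (mklin h)) (fin_gen_rV _) => -[u v].
have [x xu] := fs u; have [y yv] := gs v; exists (row_mx x y).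
by rewrite mklinE row_mxKl row_mxKr xu yv.
Qed.

(* Induction on the number of generators of the ambient module: the coefficients
   along the last generator form a finitely generated left ideal. *)
Lemma noetherian_span (V : lmodType R) (S : submodule V) n (g : 'I_n -> V) :
  left_noetherian R ->
  (forall x, S x -> exists c : 'I_n -> R, x = \sum_i c i *: g i) ->
  exists m (s : 'I_m -> V), (forall i, S (s i)) /\
    forall x, S x -> exists c : 'I_m -> R, x = \sum_i c i *: s i.
Proof.
move=> noeth; elim: n V S g => [|n IHn] V S g Sg.
  exists 0%N, (fun i => 0); split=> [[]//|x /Sg [c ->]].
  by exists c; rewrite !big_ord0.
pose g' i := g (lift ord_max i).
pose T x := exists c : 'I_n -> R, x = \sum_i c i *: g' i.
have T0 : T 0 by exists (fun=> 0); rewrite big1 // => i _; rewrite scale0r.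
have TP a x y : T x -> T y -> T (a *: x + y).
  move=> [c ->] [d ->]; exists (fun i => a * c i + d i).
  rewrite scaler_sumr -big_split /=; apply: eq_bigr => i _.
  by rewrite scalerDl scalerA.
have TD x y : T x -> T y -> T (x + y) by move=> *; rewrite -[x]scale1r; apply: TP.
pose I a := exists2 x, S x & T (x - a *: g ord_max).
have SD x y : S x -> S y -> S (x + y) by move=> *; rewrite -[x]scale1r; apply: smemP.
have idI : is_left_ideal I.
  split.
  - by exists 0; rewrite ?scale0r ?subr0 //; apply: smem0.
  - move=> a b [x Sx Tx] [y Sy Ty]; exists (x + y); first exact: SD.
    by rewrite scalerDl opprD addrACA; apply: TD.
  - move=> a b [x Sx Tx]; exists (a *: x).
      by rewrite -[_ *: _]addr0; apply: smemP => //; apply: smem0.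
    by rewrite -scalerA -scalerBr -[_ *: _]addr0; apply: TP.
have [k [b [Ib Igen]]] := noeth I idI.
have /choice [s /all_and2 [Ss Ts]] : forall i, exists x, S x /\ T (x - b i *: g ord_max).
  by move=> i; have [x] := Ib i; exists x.
have S'0 : S 0 /\ T 0 by split=> //; apply: smem0.
have S'P a x y : S x /\ T x -> S y /\ T y -> S (a *: x + y) /\ T (a *: x + y).
  by move=> [? ?] [? ?]; split; [apply: smemP | apply: TP].
have [|m [t [St tgen]]] := IHn V (Submodule S'0 S'P) g'; first by move=> x [].
exists (k + m)%N, (fun i => match split i with inl j => s j | inr j => t j end).
split; first by move=> i; case: split => j //; case: (St j).
move=> x Sx.
have spl i : split (lshift m i) = inl i := unsplitK (inl i).
have spr i : split (rshift k i) = inr i := unsplitK (inr i).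
have [c xE] := Sg x Sx.
have [|d dE] := Igen (c ord_max).
  exists x => //; exists (fun i => c (lift ord_max i)).
  by rewrite xE (bigD1_ord ord_max) //= addrAC subrr add0r.
have Tx : T (x - c ord_max *: g ord_max).
  exists (fun i => c (lift ord_max i)).
  by rewrite {1}xE (bigD1_ord ord_max) //= addrAC subrr add0r.
have Ssum : S (\sum_i d i *: s i).
  elim/big_ind: _ => [|? ?|i _]; [exact: smem0 | exact: SD | ].
  by rewrite -[_ *: _]addr0; apply: smemP => //; apply: smem0.
have Tsum : T (\sum_i d i *: (s i - b i *: g ord_max)).
  elim/big_ind: _ => [|? ?|i _]; [exact: T0 | exact: TD | ].
  by rewrite -[_ *: _]addr0; apply: TP => //; apply: smem0.
have [|e eE] := tgen (x - \sum_i d i *: s i).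
  split; first by rewrite addrC -scaleN1r; apply: smemP.
  suff -> : x - \sum_i d i *: s i = (-1) *: (\sum_i d i *: (s i - b i *: g ord_max)) +
      (x - c ord_max *: g ord_max) by apply: TP.
  under [in RHS]eq_bigr => i _ do rewrite scalerBr scalerA.
  by rewrite sumrB -scaler_suml -dE scaleN1r opprB [RHS]addrC addrA subrK.
exists (fun i => match split i with inl j => d j | inr j => e j end).
rewrite big_split_ord /=.
under [X in _ = X + _]eq_bigr => i _ do rewrite spl.
under [X in _ = _ + X]eq_bigr => i _ do rewrite spr.
by rewrite -eE [RHS]addrC subrK.
Qed.

Lemma fin_gen_sub V (S : submodule V) :
  left_noetherian R -> fin_gen V -> fin_gen (sub_of S).
Proof.
move=> noeth [n [g gV]].
have [m [s [Ss sgen]]] := noetherian_span noeth (fun x (_ : S x) => gV x).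
have /choice [t tE] := fun i => sub_val_mk (Ss i).
exists m, t => x; have [c cE] := sgen _ (sub_valP x); exists c.
apply: sub_val_inj; rewrite cE linear_sum; apply: eq_bigr => i _.
by rewrite linearZ -tE.
Qed.

Section Conditional.
Variables (V : lmodType R) (b : bool).

Definition csub_mem (x : V) : Prop := b -> x = 0.
Lemma csub_mem0 : csub_mem 0. Proof. by []. Qed.
Lemma csub_memP a x y : csub_mem x -> csub_mem y -> csub_mem (a *: x + y).
Proof. by move=> hx hy hb; rewrite hx // hy // scaler0 addr0. Qed.

Definition csub_submod := Submodule csub_mem0 csub_memP.
Definition csub : lmodType R := sub_of csub_submod.
Definition cval : {linear csub -> V} := sub_val csub_submod.

Lemma cval_inj : injective cval. Proof. exact: sub_val_inj. Qed.
Lemma cval_mk x : (b -> x = 0) -> exists y, cval y = x.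
Proof. exact: (@sub_val_mk _ csub_submod). Qed.
Lemma csub0 (x : csub) : b -> x = 0.
Proof. by move=> hb; apply: cval_inj; rewrite linear0; apply: (sub_valP x). Qed.

Lemma csub_retract : retract_of csub V.
Proof.
have h : linear (fun x : V => if b then 0 else x).
  by move=> a x y; case: b => //; rewrite scaler0 addr0.
have [|r rE] := @corestrict _ _ (Submodule csub_mem0 csub_memP) (mklin h).
  by move=> x; rewrite mklinE => /= ->.
exists cval, r => x; apply: cval_inj; rewrite /cval rE mklinE.
by case: ifP => // hb; rewrite (csub0 x hb) linear0.
Qed.
End Conditional.
End Linear.
Arguments cval {R V b}.

(** * Dependent choice along the integers *)

Section Integers.

Lemma dep_choice (A : Type) (B : A -> Type) (P : forall x, B x -> Prop) :
  (forall x, exists y, P x y) -> exists f : forall x, B x, forall x, P x (f x).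
Proof. by move=> h; exists (fun x => sval (cid (h x))) => x; case: cid. Qed.

Lemma nextK (n : int) : next (n - 1) = n. Proof. by rewrite /next subrK. Qed.

(** Every degree is a successor, but only up to a transport. With [T] a family of propositions this
    is also a proof principle: it suffices to argue in degrees [next n]. *)
Definition unnext (T : int -> Type) (f : forall n, T (next n)) (n : int) : T n :=
  ecast m (T m) (nextK n) (f (n - 1)).

Lemma unnextE (T : int -> Type) (f : forall n, T (next n)) (n : int) :
  unnext f (next n) = f n.
Proof.
rewrite /unnext; move: (nextK (next n)); have -> : next n - 1 = n by rewrite /next addrK.
by move=> e; rewrite eq_axiomK.
Qed.

Section DownwardChoice.
Variables (T : int -> Type) (good : forall n, T n -> Prop).
Variables (rel : forall n, T n -> T (next n) -> Prop) (b : int) (t : forall n, T n).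
Arguments good : clear implicits.
Arguments rel : clear implicits.

Lemma downward_choice :
  (forall n : int, b < n -> good n (t n)) ->
  (forall n : int, b < n -> rel n (t n) (t (next n))) ->
  (forall n y, good (next n) y -> exists x, good n x /\ rel n x y) ->
  exists g : forall n, T n, (forall n : int, b < n -> g n = t n) /\
    (forall n, good n (g n)) /\ forall n, rel n (g n) (g (next n)).
Proof.
move=> t_good t_rel stepP.
(* The step is made total, with [t n] as default on arguments that are not good, so that the
   recursion need not carry proofs. *)
have /dep_choice [step0 step0E] : forall p : {n : int & T (next n)},
    exists x : T (tag p), good _ (tagged p) -> good _ x /\ rel _ x (tagged p).
  move=> [n y] /=; have [gy|ngy] := EM (good _ y); last by exists (t n).
  by have [x] := stepP _ _ gy; exists x.
pose step n (y : T (next n)) : T n := step0 (existT _ n y).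
have stepE (n : int) y : good _ y -> good n (step n y) /\ rel n (step n y) y.
  exact: (step0E (existT _ n y)).
(* The fuel is the distance from [n] to [b + 1]. It is positive on both sides of [b + 1], hence the
   test [b < n]. *)
pose fix G k (n : int) {struct k} : T n := if k is k'.+1 then
  if b < n then t n else step n (G k' (next n)) else t n.
pose g (n : int) := G (absz (b + 1 - n)%R) n.
have gt (n : int) : b < n -> g n = t n by rewrite /g; case: (absz _) => //= k ->.
have gs (n : int) : n <= b -> g n = step n (g (next n)).
  move=> nb; rewrite /g.
  have -> : (absz (b + 1 - n)%R) = (absz (b + 1 - next n)%R).+1 by rewrite /next; lia.
  by rewrite /= ltNge nb.
have ggood (n : int) : good n (g n).
  have [k] : exists k, k = (absz (b + 1 - n)%R) by exists (absz (b + 1 - n)%R).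
  elim: k n => [|k IHk] n kE; have [bn|nb] := ltP b n; try by rewrite gt //; apply: t_good.
    by lia.
  by rewrite gs //; apply: (stepE _ _ _).1; apply: IHk; rewrite /next; lia.
exists g; split=> //; split=> // n; have [bn|nb] := ltP b n.
  by rewrite !gt //; [apply: t_rel | rewrite /next; lia].
by rewrite (gs n) //; apply: (stepE _ _ _).2.
Qed.
End DownwardChoice.

Section UpwardChoice.
Variables (T : int -> Type) (good : forall n, T n -> Prop).
Variables (rel : forall n, T n -> T (next n) -> Prop) (c : int) (t : forall n, T n).
Arguments good : clear implicits.
Arguments rel : clear implicits.

Lemma upward_choice :
  good c (t c) ->
  (forall n : int, n < c -> rel n (t n) (t (next n))) ->
  (forall n x, c <= n -> good n x -> exists y, good (next n) y /\ rel n x y) ->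
  exists g : forall n, T n,
    (forall n : int, n <= c -> g n = t n) /\ forall n, rel n (g n) (g (next n)).
Proof.
move=> t_good t_rel stepP.
have /dep_choice [step0 step0E] : forall p : {n : int & T n},
    exists y : T (next (tag p)), c <= tag p -> good _ (tagged p) ->
      good _ y /\ rel _ (tagged p) y.
  move=> [n x] /=; have [[cn gx]|ngx] := EM (c <= n /\ good _ x).
    by have [y] := stepP _ _ cn gx; exists y.
  by exists (t (next n)) => cn gx; case: ngx.
pose step n (x : T n) : T (next n) := step0 (existT _ n x).
have stepE (n : int) x : c <= n -> good _ x -> good _ (step n x) /\ rel n x (step n x).
  exact: (step0E (existT _ n x)).
pose fix G k (n : int) {struct k} : T n := if k is k'.+1 then
  unnext (fun m => if c <= m then step m (G k' m) else t (next m)) n else t n.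
pose g (n : int) := G (absz (n - c)%R) n.
have gt (n : int) : n <= c -> g n = t n.
  rewrite /g; case: (absz _) => //= k; rewrite -(nextK n) => nc.
  by rewrite unnextE ifF //; move: nc; rewrite /next; lia.
have gs (n : int) : c <= n -> g (next n) = step n (g n).
  move=> cn; rewrite /g.
  have -> : (absz (next n - c)%R) = (absz (n - c)%R).+1 by rewrite /next; lia.
  by rewrite /= unnextE cn.
have ggood (n : int) : c <= n -> good n (g n).
  have [k] : exists k, k = (absz (n - c)%R) by exists (absz (n - c)%R).
  elim: k n => [|k IHk] n kE cn.
    by have -> : n = c by [lia]; rewrite gt.
  rewrite -(nextK n) gs; last by lia.
  by apply: (stepE _ _ _ _).1; [lia | apply: IHk; lia].
exists g; split=> // n; have [nc|cn] := ltP n c.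
  by rewrite !gt; [apply: t_rel | rewrite /next; lia | lia].
by rewrite gs //; apply: (stepE _ _ _ _).2 => //; apply: ggood.
Qed.
End UpwardChoice.
End Integers.

(** * Unbounded complexes and homotopies *)

Section Complexes.
Variable R : pzRingType.

Record ucx := UCx {
  uc :> int -> lmodType R;
  ud : forall n, {linear uc n -> uc (next n)};
  udd : forall n x, ud (next n) (ud n x) = 0 }.

Record umap (X Y : ucx) := UMap {
  um :> forall n, {linear X n -> Y n};
  umd : forall n x, um (next n) (ud X n x) = ud Y n (um n x) }.

Definition umap_comp (X Y Z : ucx) (g : umap Y Z) (f : umap X Y) : umap X Z.
Proof. by exists (fun n => g n \o f n) => n x /=; rewrite !umd. Defined.

Definition umap_id (X : ucx) : umap X X :=
  @UMap X X (fun n => idfun) (fun n x => erefl).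

Definition umap0 (X Y : ucx) : umap X Y.
Proof. by exists (fun n => \0) => n x /=; rewrite linear0. Defined.

Definition ubc (X : bcomplex R) : ucx := UCx (@cx_dd R X).
Definition ubm (X Y : bcomplex R) (f : cmap X Y) : umap (ubc X) (ubc Y) :=
  @UMap (ubc X) (ubc Y) f (@cm_d R X Y f).

(** Exactness in degree [n + 1]; with this index the incoming differential needs no transport. *)
Definition exact_at (E : ucx) (n : int) :=
  forall x : E (next n), ud E (next n) x = 0 -> exists y, ud E n y = x.

Definition uqi (X Y : ucx) (f : umap X Y) : Prop := forall n,
  (forall x : X (next n), ud X (next n) x = 0 ->
     (exists y, ud Y n y = f (next n) x) -> exists x', ud X n x' = x) /\
  (forall y : Y (next n), ud Y (next n) y = 0 ->
     exists x : X (next n),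
       ud X (next n) x = 0 /\ exists y', f (next n) x - y = ud Y n y').

Definition homotopic (X Y : ucx) (f g : umap X Y) : Prop :=
  exists h : forall n, {linear X (next n) -> Y n}, forall n x,
    f (next n) x - g (next n) x = ud Y n (h n x) + h (next n) (ud X (next n) x).

Lemma homotopic_ext X Y (f g : umap X Y) : (forall n x, f n x = g n x) -> homotopic f g.
Proof.
by move=> fg; exists (fun n => \0) => n x; rewrite fg subrr /= linear0 addr0.
Qed.

Lemma homotopic_refl X Y (f : umap X Y) : homotopic f f.
Proof. exact: homotopic_ext. Qed.

Lemma homotopic_sym X Y (f g : umap X Y) : homotopic f g -> homotopic g f.
Proof.
move=> [h hE]; exists (fun n => \- h n) => n x /=.
by rewrite linearN -opprD -hE opprB.
Qed.

Lemma homotopic_trans X Y (f g k : umap X Y) :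
  homotopic f g -> homotopic g k -> homotopic f k.
Proof.
move=> [h hE] [h' h'E]; exists (fun n => h n \+ h' n) => n x /=.
by rewrite linearD addrACA -hE -h'E addrA subrK.
Qed.

Lemma homotopic_compl X Y Z (k : umap Y Z) (f g : umap X Y) :
  homotopic f g -> homotopic (umap_comp k f) (umap_comp k g).
Proof.
move=> [h hE]; exists (fun n => k n \o h n) => n x /=.
by rewrite -linearB hE linearD umd.
Qed.

Definition uprojective (Q : ucx) := forall n, projective (Q n).
Definition bounded_above (Q : ucx) := exists b : int, forall n, b < n -> forall x : Q n, x = 0.

(** The homotopy is chosen from the top of [Q] downward. The invariant [good] says that [f - h' d]
    takes values in cycles; these are boundaries where [E] is exact, so projectivity lifts it
    through the differential. Where [Q (next n)] is zero, the zero map serves. *)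
Lemma null_homotopic Q E (f : umap Q E) : uprojective Q -> bounded_above Q ->
  (forall n, (forall x : Q (next n), x = 0) \/ exact_at E n) ->
  homotopic f (umap0 Q E).
Proof.
move=> Qp [b Qb] QE.
pose T n := {linear Q (next n) -> E n}.
pose good n (h : T n) := forall x, ud E n (h (ud Q n x)) = ud E n (f n x).
pose rel n (h : T n) (h' : T (next n)) := forall x : Q (next n),
  f (next n) x = ud E n (h x) + h' (ud Q (next n) x).
have Qb' n : b < n -> forall x : Q (next n), x = 0.
  by move=> bn; apply: Qb; rewrite /next; lia.
have [||n h' gh'|g [_ [_ gE]]] := @downward_choice T good rel b (fun n => \0).
- move=> n bn x; rewrite (Qb n bn x) !linear0 //.
- by move=> n bn x; rewrite (Qb' n bn x) !linear0 /= addr0.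
- suff [h hE] : exists h : T n, rel n h h'.
    exists h; split=> // x; rewrite -umd hE udd linear0 addr0 //.
  have [Q0|En] := QE n.
    by exists \0 => x; rewrite (Q0 x) !linear0 /= addr0.
  pose p : {linear Q (next n) -> E (next n)} := f (next n) \- (h' \o ud Q (next n)).
  have [x|h hE] := @proj_lift _ _ _ _ (ud E n) p (Qp _).
    by apply: En; rewrite /= linearB gh' subrr.
  by exists h => x; rewrite hE /= subrK.
by exists g => n x /=; rewrite subr0; apply: gE.
Qed.

Definition acyclic (E : ucx) := forall n, exact_at E n.

(** * Mapping cones and lifting along quasi-isomorphisms *)

Section UCone.
Variables (Y Z : ucx) (s : umap Y Z).

Definition ucone_mod (n : int) : lmodType R := (Y (next n) * Z n)%type.
Definition ucone_fun n (p : ucone_mod n) : ucone_mod (next n) :=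
  (- ud Y (next n) p.1, s (next n) p.1 + ud Z n p.2).
Lemma ucone_linear n : linear (@ucone_fun n).
Proof.
move=> a [x y] [x' y']; rewrite /ucone_fun; congr pair => /=.
  by rewrite linearP opprD scalerN.
by rewrite !linearP scalerDr addrACA.
Qed.
Definition ucone : ucx.
Proof.
exists ucone_mod (fun n => mklin (@ucone_linear n)) => n [x y].
rewrite !mklinE /ucone_fun /=; congr pair.
  by rewrite linearN udd !oppr0.
by rewrite linearN linearD udd addr0 umd addNr.
Defined.

Lemma uconeE n (p : ucone n) :
  ud ucone n p = (- ud Y (next n) p.1, s (next n) p.1 + ud Z n p.2).
Proof. by []. Qed.

Lemma ucone_acyclic : uqi s -> acyclic ucone.
Proof.
move=> qs n [y z]; rewrite uconeE /= => -[/eqP]; rewrite oppr_eq0 => /eqP dy sz.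
have [inj _] := qs (next n); have [_ surj] := qs n.
have [|y1 y1E] := inj y dy.
  by exists (- z); rewrite linearN; apply/eqP; rewrite eq_sym -subr_eq0 opprK sz.
have [|y2 [dy2 [z2 z2E]]] := surj (z + s (next n) y1).
  by rewrite linearD -umd y1E addrC.
exists (y2 - y1, - z2); congr pair => /=.
  by rewrite linearB dy2 y1E sub0r opprK.
by rewrite linearB [ud _ _ _]linearN -z2E opprB addrC addrA subrK addrK.
Qed.
End UCone.

Section Comparison.
Variables (Q Y Z : ucx) (s : umap Y Z).
Hypotheses (Qp : uprojective Q) (Qb : bounded_above Q) (qs : uqi s).

(** The map [(0, g)] into the acyclic cone of [s] is null-homotopic. The first component of the
    null-homotopy is the lift, the second the homotopy between [s f] and [g]. *)
Lemma lift_quasi_iso (g : umap Q Z) : exists f : umap Q Y, homotopic (umap_comp s f) g.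
Proof.
have h n : linear (fun x : Q n => (0, g n x) : ucone s n).
  by move=> a x y; rewrite linearP; congr pair; rewrite /= scaler0 addr0.
have hd n x : mklin (h (next n)) (ud Q n x) = ud (ucone s) n (mklin (h n) x).
  by rewrite uconeE; congr pair => /=; rewrite linear0 ?oppr0 ?add0r ?umd.
have ca : acyclic (ucone s) := ucone_acyclic qs.
have [k kE] := null_homotopic (UMap hd) Qp Qb (fun n => or_intror (ca n)).
pose f := unnext (T := fun n => {linear Q n -> Y n}) (fun n => fst \o k n).
have fE n : f (next n) = fst \o k n by rewrite /f unnextE.
have kE1 n x : ud Y (next n) (k n x).1 = (k (next n) (ud Q (next n) x)).1.
  have := congr1 fst (kE n x); rewrite uconeE mklinE /= subr0.
  by move/eqP; rewrite eq_sym addrC subr_eq0 => /eqP.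
have fd : forall n (x : Q n), f (next n) (ud Q n x) = ud Y n (f n x).
  by apply: unnext => n x; rewrite !fE /= kE1.
exists (UMap fd); apply: homotopic_sym; exists (fun n => snd \o k n) => n x /=.
have := congr1 snd (kE n x); rewrite uconeE mklinE /= subr0 => ->.
have -> : f (next n) x = (k n x).1 by rewrite fE.
by rewrite addrAC [_ + _ - _]addrAC subrr add0r.
Qed.

(** A homotopy [k] from [s f] to [s f'] makes [(f - f', - k)] a chain map from the shift [Q'] of [Q]
    to the cone of [s]. The first component of its null-homotopy is, up to sign, a homotopy from [f]
    to [f']. *)
Lemma cancel_quasi_iso (f f' : umap Q Y) :
  homotopic (umap_comp s f) (umap_comp s f') -> homotopic f f'.
Proof.
move=> [k kE].
have dd n (x : Q (next n)) :
    (\- ud Q (next (next n)) : {linear _ -> _}) ((\- ud Q (next n) : {linear _ -> _}) x) = 0.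
  by rewrite /= linearN udd !oppr0.
pose Q' : ucx := @UCx (fun n => Q (next n)) (fun n => \- ud Q (next n)) dd.
have Q'p : uprojective Q' by move=> n; apply: Qp.
have Q'b : bounded_above Q'.
  by have [b bE] := Qb; exists b => n bn; apply: bE; rewrite /next; lia.
have h n : linear (fun x : Q' n => (f (next n) x - f' (next n) x, - k n x) : ucone s n).
  move=> a x y; congr pair => /=.
    by rewrite !linearP scalerDr addrACA.
  by rewrite !linearP.
have hd n x : mklin (h (next n)) (ud Q' n x) = ud (ucone s) n (mklin (h n) x).
  rewrite uconeE; congr pair => /=; first by rewrite linearB opprB -!umd [f _ _]linearN [f' _ _]linearN opprK addrC.
  by rewrite linearB kE !linearN opprK addrC addKr.
have ca : acyclic (ucone s) := ucone_acyclic qs.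
have [g gE] := null_homotopic (UMap hd) Q'p Q'b (fun n => or_intror (ca n)).
pose r := unnext (T := fun n => {linear Q (next n) -> Y n}) (fun n => \- (fst \o g n)).
have rE n : r (next n) = \- (fst \o g n) by rewrite /r unnextE.
exists r; apply: unnext => n x; rewrite !rE /=.
have := congr1 fst (gE n x); rewrite uconeE mklinE /= subr0 => ->.
by rewrite !linearN.
Qed.
End Comparison.
End Complexes.

(** * Truncations *)

Section Truncation.
Variables (R : pzRingType) (Q : ucx R) (k : int).

Definition trunc_fun n (x : Q n) : (Q n * Q (next n))%type :=
  (if k <= n then x else 0, if k <= next n then ud Q n x else 0).
Lemma trunc_linear n : linear (@trunc_fun n : Q n -> (Q n * Q (next n))%type).
Proof.
move=> a x y; rewrite /trunc_fun; congr pair => /=; case: ifP => _ //=;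
  by rewrite ?linearP // scaler0 addr0.
Qed.
Definition trunc_map n := mklin (@trunc_linear n).
Definition trunc_mod n : lmodType R := sub_of (im (trunc_map n)).
Definition trunc_val n : {linear trunc_mod n -> (Q n * Q (next n))%type} :=
  sub_val (im (trunc_map n)).

Arguments trunc_val {n}.

Lemma trunc_val_inj n : injective (@trunc_val n).
Proof. exact: sub_val_inj. Qed.

Lemma trunc_surj n (w : trunc_mod n) : exists x, trunc_val w = trunc_fun x.
Proof. by have [x xE] := sub_valP w; exists x; rewrite /trunc_val -xE. Qed.

Lemma trunc_d_proof n :
  exists d : {linear trunc_mod n -> trunc_mod (next n)},
    forall w, trunc_val (d w) = ((trunc_val w).2, 0).
Proof.
have h : linear (fun w : trunc_mod n =>
    ((trunc_val w).2, 0) : (Q (next n) * Q (next (next n)))%type).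
  by move=> a x y; rewrite linearP; congr pair; rewrite /= scaler0 addr0.
have [w|d dE] := @corestrict _ _ _ (im (trunc_map (next n))) (mklin h).
  have [x xE] := trunc_surj w; exists (ud Q n x); rewrite !mklinE xE /trunc_fun /=.
  by rewrite udd; case: ifP => //; case: ifP.
by exists d => w; rewrite /trunc_val dE.
Qed.
Definition trunc_d n := sval (cid (trunc_d_proof n)).
Lemma trunc_dE n w : trunc_val (trunc_d n w) = ((trunc_val w).2, 0).
Proof. by rewrite /trunc_d; case: cid. Qed.

Lemma trunc_dd n w : trunc_d (next n) (trunc_d n w) = 0.
Proof. by apply: trunc_val_inj; rewrite linear0 !trunc_dE. Qed.

(* The quotient of Q by its subcomplex of terms of degree < k - 1 and cycles of
   degree k - 1, realized as the image of x |-> ([k <= n] x, [k <= n + 1] d x);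
   it has the cohomology of Q in degrees >= k and none below. *)
Definition trunc : ucx R := UCx trunc_dd.

Lemma trunc_proj_proof n :
  exists p : {linear Q n -> trunc n}, forall x, trunc_val (p x) = trunc_fun x.
Proof.
have [x|p pE] := @corestrict _ _ _ (im (trunc_map n)) (trunc_map n); first by exists x.
by exists p.
Qed.

Definition trunc_proj : umap Q trunc.
Proof.
exists (fun n => sval (cid (trunc_proj_proof n))) => n x.
apply: trunc_val_inj; rewrite [ud trunc n]/(ud _ _) trunc_dE; do 2![case: cid => /= ? ->].
by rewrite /trunc_fun /= udd if_same.
Defined.
Lemma trunc_projE n x : trunc_val (trunc_proj n x) = trunc_fun x.
Proof. by rewrite /trunc_proj /=; case: cid. Qed.

Lemma trunc_proj_surj n (w : trunc n) : exists x, trunc_proj n x = w.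
Proof.
have [x xE] := trunc_surj w; exists x; apply: trunc_val_inj.
by rewrite trunc_projE xE.
Qed.

Lemma trunc_low n (w : trunc n) : next n < k -> w = 0.
Proof.
move=> nk; apply: trunc_val_inj; have [x ->] := trunc_surj w.
by rewrite /trunc_fun !ifF ?linear0 //; move: nk; rewrite /next; lia.
Qed.

Lemma trunc_exact_low n : next n < k -> exact_at trunc n.
Proof.
move=> nk w dw; exists 0; rewrite linear0; apply: trunc_val_inj; rewrite linear0.
have w2 : (trunc_val w).2 = 0 by have := congr1 trunc_val dw; rewrite trunc_dE linear0 => -[].
rewrite [RHS]surjective_pairing w2; have [x ->] := trunc_surj w.
by rewrite /trunc_fun /= ifF //; move: nk; rewrite /next; lia.
Qed.

Lemma trunc_proj_d n x y : k <= next n ->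
  trunc_proj (next n) x = ud trunc n (trunc_proj n y) -> x = ud Q n y.
Proof.
move=> kn /(congr1 trunc_val); rewrite trunc_projE trunc_dE trunc_projE /trunc_fun /=.
by rewrite kn => -[].
Qed.

Lemma trunc_retract n : k <= n -> retract_of (trunc n) (Q n).
Proof.
move=> kn.
have h : linear (fun w : trunc n => (trunc_val w).1) by move=> a x y; rewrite linearP.
exists (mklin h), (trunc_proj n) => w; apply: trunc_val_inj; rewrite trunc_projE mklinE.
have [x ->] := trunc_surj w.
by rewrite /trunc_fun /= kn.
Qed.

Section Factor.
Variables (X : ucx R) (Xk : forall n, n < k -> forall x : X n, x = 0).

(** From degree [k] on, the first component of [w] is the element of [Q] that it comes from; below
    [k] the target is zero, so the formula is right in all degrees. *)
Definition factor_fun (g : forall n, {linear Q n -> X n}) n (w : trunc n) : X n :=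
  g n (trunc_val w).1.
Lemma factor_linear g n : linear (@factor_fun g n).
Proof. by move=> a x y; rewrite /factor_fun !linearP. Qed.

Lemma factor_d (g : umap Q X) n w :
  mklin (@factor_linear g (next n)) (ud trunc n w) = ud X n (mklin (@factor_linear g n) w).
Proof.
have [x <-] := trunc_proj_surj w.
rewrite !mklinE /factor_fun trunc_dE trunc_projE /trunc_fun /=.
case: (leP k (next n)) => kn; last by rewrite [LHS]Xk ?[RHS]Xk.
case: (leP k n) => kn'; first exact: umd.
by rewrite linear0 umd [g n x]Xk.
Qed.

Definition factor (g : umap Q X) : umap trunc X := UMap (@factor_d g).

Lemma factorE g n x : factor g n (trunc_proj n x) = g n x.
Proof.
rewrite /factor /= /factor_fun trunc_projE /=; case: leP => // nk.
by rewrite [LHS]Xk ?[RHS]Xk.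
Qed.

Lemma factor_homotopic g g' : homotopic g g' -> homotopic (factor g) (factor g').
Proof.
move=> [h hE].
have hl n : linear (fun w : trunc (next n) => h n (trunc_val w).1).
  by move=> a x y; rewrite !linearP.
exists (fun n => mklin (hl n)) => n w; have [x <-] := trunc_proj_surj w.
rewrite !factorE !mklinE trunc_dE !trunc_projE /trunc_fun /=.
case: (leP k (next n)) => nk.
  by rewrite ifT ?hE //; move: nk; rewrite /next; lia.
by rewrite [LHS]Xk // [RHS]Xk.
Qed.

Lemma factor_uqi g : uqi g -> uqi (factor g).
Proof.
move=> qg n; split=> [w dw [y yE]|y dy].
  have [nk|kn] := ltP (next n) k; first exact: trunc_exact_low.
  have [x xE] := trunc_proj_surj w; move: dw yE; rewrite -xE factorE => dx yE.
  have [|x' x'E] := (qg n).1 x _ (ex_intro _ y yE).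
    have kn' : k <= next (next n) by move: kn; rewrite /next; lia.
    have := congr1 trunc_val dx; rewrite trunc_dE trunc_projE linear0 /trunc_fun /= kn'.
    by case.
  by exists (trunc_proj n x'); rewrite -umd x'E.
have [x [dx [y' y'E]]] := (qg n).2 y dy.
exists (trunc_proj _ x); rewrite -umd dx linear0; split=> //.
by exists y'; rewrite factorE.
Qed.
End Factor.
End Truncation.
Arguments trunc_val {R Q k n}.

(** * Morphisms of the derived category *)

Section Cylinder.
Variables (R : pzRingType) (X : bcomplex R).

(** Up to signs, the mapping cylinder of the identity of [X]. *)
Definition cyl_mod (n : int) : lmodType R := (X n * X (next n) * X n)%type.
Definition cyl_fun n (p : cyl_mod n) : cyl_mod (next n) :=
  (cx_d X n p.1.1 + p.1.2, - cx_d X (next n) p.1.2, cx_d X n p.2 - p.1.2).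
Lemma cyl_linear n : linear (@cyl_fun n).
Proof.
move=> a [[x y] z] [[x' y'] z']; rewrite /cyl_fun; congr pair; first congr pair => /=.
- by rewrite linearP scalerDr addrACA.
- by rewrite linearP opprD scalerN.
- by rewrite /= linearP opprD scalerBr addrACA.
Qed.

Definition cyl : bcomplex R.
Proof.
exists cyl_mod (fun n => mklin (@cyl_linear n)).
- move=> n [[x y] z]; rewrite !mklinE /cyl_fun /=; congr pair; first congr pair.
  + by rewrite linearD cx_dd add0r subrr.
  + by rewrite linearN cx_dd !oppr0.
  + by rewrite linearB cx_dd sub0r opprK addNr.
- by move=> n; do !apply: fin_gen_prod; apply: cx_fg.
- have [N1 H1] := cx_bounded X; have [N2 H2] := cx_bounded (shift X).
  exists (maxn N1 N2) => n; rewrite gtn_max => /andP[/H1 h1 /H2 h2] [[x y] z].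
  by rewrite (h1 x) (h1 z) (h2 y).
Defined.

Lemma cylE n (p : cyl n) : cx_d cyl n p =
  (cx_d X n p.1.1 + p.1.2, - cx_d X (next n) p.1.2, cx_d X n p.2 - p.1.2).
Proof. by []. Qed.

Lemma cyl_proj_linear n : linear (fun p : cyl n => p.1.1 + p.2 : X n).
Proof. by move=> a [[x y] z] [[x' y'] z'] /=; rewrite scalerDr addrACA. Qed.
Definition cyl_proj : cmap cyl X.
Proof.
exists (fun n => mklin (@cyl_proj_linear n)) => n p.
by rewrite !mklinE /cyl_fun /= linearD -addrA subrKC.
Defined.

Lemma cyl_in1_linear n : linear (fun x : X n => (x, 0, 0) : cyl n).
Proof.
move=> a x y; congr pair; rewrite /= ?scaler0 ?addr0 //.
by congr pair; rewrite /= scaler0 addr0.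
Qed.
Definition cyl_in1 : cmap X cyl.
Proof.
exists (fun n => mklin (@cyl_in1_linear n)) => n x; rewrite !mklinE /cyl_fun /=.
by rewrite !linear0 ?addr0 ?subr0 ?oppr0.
Defined.

Lemma cyl_in2_linear n : linear (fun x : X n => (0, 0, x) : cyl n).
Proof. by move=> a x y; congr pair; rewrite //=; congr pair; rewrite /= scaler0 addr0. Qed.
Definition cyl_in2 : cmap X cyl.
Proof.
exists (fun n => mklin (@cyl_in2_linear n)) => n x; rewrite !mklinE /cyl_fun /=.
by rewrite !linear0 ?addr0 ?subr0 ?oppr0.
Defined.

Lemma cyl_qi : quasi_iso cyl_proj.
Proof.
move=> n; split=> [[[a b] c]|y dy].
  rewrite cylE /= => -[_ _ /eqP]; rewrite subr_eq0 => /eqP dc [y yE].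
  exists (y, - c, 0); congr pair; first congr pair => /=.
  + by rewrite yE /= addrK.
  + by rewrite linearN dc opprK.
  + by rewrite linear0 sub0r opprK.
exists (y, 0, 0); rewrite /= /cyl_fun /= dy !linear0 ?addr0 ?subr0 ?oppr0; split=> //.
by exists 0; rewrite linear0 ?addr0 subrr.
Qed.

End Cylinder.

(** The homotopy is a map [k] from the cylinder that restricts to [f] and [g] on the two ends. Both
    ends are sections of the quasi-isomorphism [cyl_proj], so in the localization both equal its
    inverse. *)
Lemma zz_eq_homotopic (R : pzRingType) (X Y : bcomplex R) (f g : cmap X Y) :
  homotopic (ubm f) (ubm g) -> zz_eq (zz_map f) (zz_map g).
Proof.
move=> [h hE].
have k_lin n : linear (fun p : cyl X n => f n p.1.1 + h n p.1.2 + g n p.2 : Y n).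
  move=> a [[x y] z] [[x' y'] z'] /=; rewrite !linearP !scalerDr.
  by rewrite [X in X + _ = _]addrACA [LHS]addrACA.
have k_d n (p : cyl X n) :
    mklin (k_lin (next n)) (cx_d (cyl X) n p) = cx_d Y n (mklin (k_lin n) p).
  have hp : cx_d Y n (h n p.1.2) = f (next n) p.1.2 - g (next n) p.1.2 -
      h (next n) (cx_d X (next n) p.1.2).
    by have /= -> := hE n p.1.2; rewrite addrK.
  rewrite !mklinE /cyl_fun /= !linearD hp !cm_d !linearN -!addrA; congr (_ + (_ + _)).
  by rewrite [RHS]addrC addrA.
pose k : cmap (cyl X) Y := CMap k_d.
have io (i : cmap X (cyl X)) : (forall n x, cyl_proj X n (i n x) = x) ->
    zz_eq (zz_map i) (zz_inv (@cyl_qi R X)).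
  move=> pi; apply: zz_trans (zz_sym (zz_idl _)) _.
  apply: zz_trans (zz_comp_eq (zz_sym (zz_inv_l (@cyl_qi R X))) (zz_refl _)) _.
  apply: zz_trans (zz_sym (zz_assoc _ _ _)) _.
  apply: zz_trans (zz_idr _); apply: zz_comp_eq (zz_refl _) _.
  by apply: zz_trans (zz_sym (zz_map_comp _ _)) _; apply: zz_map_ext => n x; apply: pi.
have fE : zz_eq (zz_map f) (zz_comp (zz_map k) (zz_map (cyl_in1 X))).
  apply: zz_trans (zz_map_comp _ _); apply: zz_map_ext => n x.
  by rewrite /= !linear0 !addr0.
have gE : zz_eq (zz_map g) (zz_comp (zz_map k) (zz_map (cyl_in2 X))).
  apply: zz_trans (zz_map_comp _ _); apply: zz_map_ext => n x.
  by rewrite /= !linear0 !add0r.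
apply: zz_trans fE _; apply: zz_trans (zz_sym gE).
apply: zz_comp_eq (zz_refl _) _; apply: zz_trans (io _ _) (zz_sym (io _ _)) => n x /=.
  by rewrite addr0.
by rewrite add0r.
Qed.

Section Action.
Variables (R : pzRingType) (Q : ucx R).
Hypotheses (Qp : uprojective Q) (Qb : bounded_above Q).

(* The functor of homotopy classes of maps out of Q inverts quasi-isomorphisms,
   hence is defined on zigzags; its values on them are given as relations. *)
Fixpoint act (X Y : bcomplex R) (u : zigzag X Y) : umap Q (ubc X) -> umap Q (ubc Y) -> Prop :=
  match u with
  | zz_map _ _ f => fun g g' => homotopic (umap_comp (ubm f) g) g'
  | zz_inv _ _ s _ => fun g g' => homotopic (umap_comp (ubm s) g') g
  | zz_comp _ _ _ u v => fun g g' => exists g'', act v g g'' /\ act u g'' g'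
  end.

Lemma act_homotopic X Y (u : zigzag X Y) g g' k k' :
  homotopic g k -> homotopic g' k' -> act u g g' -> act u k k'.
Proof.
elim: u g g' k k' => {X Y} /= [X Y f|X Y s qs|X Y Z u IHu v IHv] g g' k k' gk gk' a.
- apply: homotopic_trans gk'; apply: homotopic_trans a.
  exact/homotopic_compl/homotopic_sym.
- apply: homotopic_trans gk; apply: homotopic_trans a.
  exact/homotopic_compl/homotopic_sym.
- have [g'' [a1 a2]] := a; exists g''; split.
    exact: IHv gk (homotopic_refl _) a1.
  exact: IHu (homotopic_refl _) gk' a2.
Qed.

Lemma act_total X Y (u : zigzag X Y) g : exists g', act u g g'.
Proof.
elim: u g => {X Y} /= [X Y f|X Y s qs|X Y Z u IHu v IHv] g.
- by exists (umap_comp (ubm f) g); apply: homotopic_refl.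
- exact: lift_quasi_iso.
- have [g1 a1] := IHv g; have [g2 a2] := IHu g1; by exists g2, g1.
Qed.

(** The two relations for formal inverses carry the content: [zz_inv_l] rests on the uniqueness of
    lifts up to homotopy, [zz_inv_r] on their existence. *)
Lemma act_eq X Y (u v : zigzag X Y) : zz_eq u v -> forall g g', act u g g' <-> act v g g'.
Proof.
have refl := homotopic_refl.
elim=> {X Y u v} /=.
- by [].
- by move=> X Y u v _ IH g g'; split=> /IH.
- by move=> X Y u v w _ IH1 _ IH2 g g'; split=> [/IH1 /IH2|/IH2 /IH1].
- by move=> X Y Z u u' v v' _ IH1 _ IH2 g g'; split=> -[k [/IH2 k1 /IH1 k2]]; exists k.
- move=> X Y u g g'; split=> [[k [k1 k2]]|a].
    apply: act_homotopic (refl _ _ _ _) _ k1.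
    by apply: homotopic_trans k2; apply: homotopic_ext.
  by exists g'; split=> //; apply: homotopic_ext.
- move=> X Y u g g'; split=> [[k [k1 k2]]|a].
    apply: act_homotopic (refl _ _ _ _) k2; apply: homotopic_sym.
    by apply: homotopic_trans k1; apply: homotopic_ext.
  by exists g; split=> //; apply: homotopic_ext.
- move=> X Y Z T u v w g g'; split=> [[k [[l [l1 l2]] k2]]|[k [k1 [l [l1 l2]]]]].
    by exists l; split=> //; exists k.
  by exists l; split=> //; exists k.
- move=> X Y f f' ff' g g'; split; apply: homotopic_trans; apply: homotopic_ext => n x /=.
    by rewrite ff'.
  by rewrite ff'.
- move=> X Y Z f f' g g'; split=> [a|[k [k1 k2]]].
    exists (umap_comp (ubm f') g); split; first exact: refl.
    by apply: homotopic_trans a; apply: homotopic_ext.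
  apply: homotopic_trans k2; apply: homotopic_trans (homotopic_compl _ k1).
  exact: homotopic_ext.
- move=> X Y s qs g g'; split=> [[k [k1 k2]]|a].
    apply: (@homotopic_trans _ _ _ _ g); first exact: homotopic_ext.
    apply: (cancel_quasi_iso (s := ubm s)) => //.
    exact: homotopic_trans k1 (homotopic_sym k2).
  exists (umap_comp (ubm s) g); split; first exact: refl.
  apply: homotopic_compl; apply: homotopic_sym; apply: homotopic_trans a.
  exact: homotopic_ext.
- move=> X Y s qs g g'; split=> [[k [k1 k2]]|a].
    apply: (@homotopic_trans _ _ _ _ g); first exact: homotopic_ext.
    exact: homotopic_trans (homotopic_sym k1) k2.
  have [k kE] := lift_quasi_iso Qp Qb (qs : uqi (ubm s)) g.
  exists k; split=> //; apply: homotopic_trans kE _.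
  by apply: homotopic_trans a; apply: homotopic_ext.
Qed.
End Action.

(** * Hom in the derived category through truncated resolutions *)

Section HomInDerivedCategory.
Variable R : pzRingType.

Definition fg_terms (Q : ucx R) := forall n, fin_gen (Q n).
Definition zero_below (k : int) (X : ucx R) := forall n, n < k -> forall x : X n, x = 0.
Definition hom0 (X Y : bcomplex R) := forall u v : zigzag X Y, zz_eq u v.
Definition nullh (Q Y : ucx R) := forall f : umap Q Y, homotopic f (umap0 Q Y).

Lemma bc_zero_below (X : bcomplex R) : exists k0, forall k, k <= k0 -> zero_below k (ubc X).
Proof.
have [N NX] := cx_bounded X; exists (- N%:Z) => k kN n nk x; apply: NX; lia.
Qed.

Lemma bc_bounded_above (X : bcomplex R) : bounded_above (ubc X).
Proof. by have [N NX] := cx_bounded X; exists N%:Z => n nk x; apply: NX; lia. Qed.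

Section Resolution.
Variables (Q : ucx R).
Hypotheses (Qb : bounded_above Q) (Qf : fg_terms Q).

Definition btrunc (k : int) : bcomplex R.
Proof.
exists (trunc_mod Q k) (trunc_d Q k); first exact: trunc_dd.
  by move=> n; apply: fin_gen_im; apply: Qf.
have [b bQ] := Qb; exists (absz k + absz b).+1 => n nN x.
have [nb|bn] := ltP b n; last by apply: (@trunc_low _ Q k n); rewrite /next; lia.
have [y <-] := trunc_proj_surj (x : trunc Q k n).
by rewrite (bQ n nb y) linear0.
Defined.

Definition bfactor k (X : bcomplex R) (Xk : zero_below k (ubc X)) (g : umap Q (ubc X)) :
  cmap (btrunc k) X := @CMap R (btrunc k) X (factor Xk g) (umd (factor Xk g)).

Lemma bfactor_homotopic k (X : bcomplex R) (Xk : zero_below k (ubc X)) g g' :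
  homotopic g g' -> zz_eq (zz_map (bfactor Xk g)) (zz_map (bfactor Xk g')).
Proof. by move=> gg'; apply: zz_eq_homotopic; apply: factor_homotopic. Qed.

Lemma bfactor_comp k (X Y : bcomplex R) (Xk : zero_below k (ubc X))
    (Yk : zero_below k (ubc Y)) (f : cmap X Y) g :
  zz_eq (zz_map (bfactor Yk (umap_comp (ubm f) g)))
    (zz_comp (zz_map f) (zz_map (bfactor Xk g))).
Proof. by apply: zz_trans (zz_map_comp _ _); apply: zz_map_ext. Qed.

(** The action agrees with composition in the category once everything is restricted to a truncation
    of [Q]. The bound depends on [u], because each intermediate complex must vanish below [k]. *)
Lemma act_trunc X Y (u : zigzag X Y) (g : umap Q (ubc X)) g' : act u g g' ->
  exists k0, forall k, k <= k0 ->
    forall (Xk : zero_below k (ubc X)) (Yk : zero_below k (ubc Y)),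
    zz_eq (zz_comp u (zz_map (bfactor Xk g))) (zz_map (bfactor Yk g')).
Proof.
elim: u g g' => {X Y} /= [X Y f|X Y s qs|X Y Z u IHu v IHv] g g' a.
- exists 0 => k _ Xk Yk; apply: zz_trans (zz_sym (bfactor_comp Xk Yk f g)) _.
  exact: bfactor_homotopic.
- exists 0 => k _ Xk Yk.
  apply: zz_trans (zz_comp_eq (zz_refl _) (zz_sym (bfactor_homotopic Xk a))) _.
  apply: zz_trans (zz_comp_eq (zz_refl _) (bfactor_comp Yk Xk s g')) _.
  apply: zz_trans (zz_assoc _ _ _) _; apply: zz_trans (zz_idl _).
  exact: zz_comp_eq (zz_inv_l qs) (zz_refl _).
- have [g'' [/IHv [k1 k1P] /IHu [k2 k2P]]] := a.
  have [k3 k3P] := bc_zero_below Y.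
  exists (Num.min k1 (Num.min k2 k3)) => k; rewrite !le_min => /and3P [kk1 kk2 kk3] Xk Yk.
  apply: zz_trans (zz_sym (zz_assoc _ _ _)) _.
  apply: zz_trans (k2P k kk2 (k3P k kk3) Yk).
  by apply: zz_comp_eq (zz_refl _) _; apply: k1P.
Qed.

Hypothesis Qp : uprojective Q.

(** A map [f] out of [Q] yields the zigzag [bfactor f] after the inverse of [bfactor q]. Its action
    on [q] gives back [f], so if it equals the zero map, [f] is null-homotopic. Conversely, [u] is
    determined by its composite with the quasi-isomorphism [bfactor q], which by [act_trunc] comes
    from a map [Q -> Y]. *)
Theorem hom0_nullh (X Y : bcomplex R) (q : umap Q (ubc X)) :
  uqi q -> hom0 X Y <-> nullh Q (ubc Y).
Proof.
move=> qq; have [kX kXP] := bc_zero_below X; have [kY kYP] := bc_zero_below Y.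
split=> [h0 f|n0 u v].
  pose k := Num.min kX kY.
  have Xk : zero_below k (ubc X) by apply: kXP; rewrite ge_min lexx.
  have Yk : zero_below k (ubc Y) by apply: kYP; rewrite ge_min lexx orbT.
  have qs : quasi_iso (bfactor Xk q) by exact: (factor_uqi Xk qq).
  pose z : cmap X Y := @CMap R X Y (umap0 (ubc X) (ubc Y)) (umd (umap0 (ubc X) (ubc Y))).
  have /(act_eq Qp Qb)/(_ q f) [zf _] :=
    h0 (zz_comp (zz_map (bfactor Yk f)) (zz_inv qs)) (zz_map z).
  have {}zf : act (zz_map z) q f.
    apply: zf; exists (trunc_proj Q k).
    by split; apply: homotopic_ext => n x; [exact: (factorE Xk q) | exact: (factorE Yk f)].
  by apply: homotopic_trans (homotopic_sym zf) _; apply: homotopic_ext.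
have [gu au] := act_total Qp Qb u q; have [gv av] := act_total Qp Qb v q.
have [ku kuP] := act_trunc au; have [kv kvP] := act_trunc av.
pose k := Num.min (Num.min kX kY) (Num.min ku kv).
have Xk : zero_below k (ubc X) by apply: kXP; rewrite !ge_min lexx.
have Yk : zero_below k (ubc Y) by apply: kYP; rewrite !ge_min lexx orbT.
have qs : quasi_iso (bfactor Xk q) by exact: (factor_uqi Xk qq).
have canc (w : zigzag X Y) : zz_eq w (zz_comp (zz_comp w (zz_map (bfactor Xk q))) (zz_inv qs)).
  apply: zz_trans (zz_assoc _ _ _); apply: zz_trans (zz_sym (zz_idr _)) _.
  exact: zz_comp_eq (zz_refl _) (zz_sym (zz_inv_r qs)).
apply: zz_trans (canc u) _; apply: zz_trans (zz_sym (canc v)).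
apply: zz_comp_eq (zz_refl _).
apply: zz_trans (kuP k _ Xk Yk) _; first by rewrite !ge_min lexx !orbT.
apply: zz_sym; apply: zz_trans (kvP k _ Xk Yk) _; first by rewrite !ge_min lexx !orbT.
by apply: bfactor_homotopic; apply: homotopic_trans (n0 _) (homotopic_sym (n0 _)).
Qed.
End Resolution.

End HomInDerivedCategory.

(** * Projective resolutions *)

Section Resolutions.
Variable R : pzRingType.
Hypothesis noeth : left_noetherian R.

Section Step.
Variables (X : bcomplex R).

(* The term in degree n of a resolution Q of X, its map to X n, and the kernel of
   its differential: all that the choice of the term in degree n - 1 depends on. *)
Record stage (n : int) := Stage {
  st_mod : lmodType R;
  st_map : {linear st_mod -> X n};
  st_cycles : submodule st_mod }.

Definition st_good n (s : stage n) := projective (st_mod s) /\ fin_gen (st_mod s).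

(** In the last clause the new term covers the pullback of the cycles of [t] and [X n] over
    [X (next n)]. For [a = 0] this gives surjectivity on cohomology; for a cycle [a] whose image is
    a boundary it gives injectivity. *)
Definition st_rel n (s : stage n) (t : stage (next n)) :=
  exists d : {linear st_mod s -> st_mod t},
  [/\ forall a, smem (st_cycles s) a <-> d a = 0,
      forall a, smem (st_cycles t) (d a),
      forall a, st_map t (d a) = cx_d X n (st_map s a)
    & forall a x, smem (st_cycles t) a -> st_map t a = cx_d X n x ->
        exists2 a', d a' = a & st_map s a' = x].

Lemma st_step n (t : stage (next n)) : st_good t ->
  exists s : stage n, st_good s /\ st_rel s t.
Proof.
move=> [tp tf].
pose K (p : (st_mod t * X n)%type) :=
  smem (st_cycles t) p.1 /\ st_map t p.1 = cx_d X n p.2.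
have K0 : K 0 by split; rewrite /= ?linear0 //; apply: smem0.
have KP a p p' : K p -> K p' -> K (a *: p + p').
  move=> [p1 p2] [p1' p2']; split; first exact: smemP.
  by rewrite !linearP /= p2 p2'.
pose KS := Submodule K0 KP.
(* Noetherianity makes the pullback finitely generated; the new term is a free module that covers
   it. *)
have [|r [f fs]] := @fin_gen_rV_surj _ (sub_of KS).
  by apply: fin_gen_sub => //; apply: fin_gen_prod => //; apply: cx_fg.
pose d : {linear 'rV[R]_r -> st_mod t} := fst \o (sub_val KS \o f).
pose q : {linear 'rV[R]_r -> X n} := snd \o (sub_val KS \o f).
have S0 : d 0 = 0 by rewrite linear0.
have SP a x y : d x = 0 -> d y = 0 -> d (a *: x + y) = 0.
  by move=> dx dy; rewrite linearP dx dy scaler0 addr0.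
exists (@Stage n _ q (Submodule S0 SP)); split.
  by split; [apply: projective_rV | apply: fin_gen_rV].
exists d; split=> // [a|a|a x Sa ax]; try by have [] := sub_valP (f a).
have [|y yE] := @sub_val_mk _ _ KS (a, x); first by [].
by have [a' a'E] := fs y; exists a'; rewrite /d /q /= a'E -[val y]/(sub_val KS y) yE.
Qed.
End Step.

Theorem resolution_exists (X : bcomplex R) (b : int) :
  (forall n, b < n -> forall x : X n, x = 0) ->
  exists (Q : ucx R) (q : umap Q (ubc X)),
    [/\ uprojective Q, fg_terms Q, (forall n, b < n -> forall x : Q n, x = 0) & uqi q].
Proof.
move=> Xb.
pose full : submodule 'rV[R]_0 := @Submodule R _ (fun=> True) I (fun _ _ _ _ _ => I).
pose t n : stage X n := @Stage X n _ \0 full.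
have rV0 (x : 'rV[R]_0) : x = 0 by exact: thinmx0.
have [n bn|n bn|n y|g [gt [gg]]] := @downward_choice _ (@st_good X) (@st_rel X) b t.
- by split; [apply: projective_rV | apply: fin_gen_rV].
- exists \0; split=> //= [a|a x _ _]; first by rewrite linear0.
  by exists 0 => //=; rewrite [x](Xb n bn).
- exact: st_step.
move=> /dep_choice [d dP].
pose Q := fun n => st_mod (g n).
have dd n x : d (next n) (d n x) = 0 by have [_ h _ _] := dP n; have [h' _ _ _] := dP (next n); apply/h'.
pose U := @UCx R Q d dd.
have qd n x : st_map (g (next n)) (ud U n x) = ud (ubc X) n (st_map (g n) x) by have [_ _ h _] := dP n.
exists U, (@UMap R U (ubc X) (fun n => st_map (g n)) qd); split.
- by move=> n; have [] := gg n.
- by move=> n; have [] := gg n.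
- by move=> n bn; rewrite /= /Q gt //= => x; apply: rV0.
- move=> n; split=> [x dx [y yE]|y dy].
    have [_ _ _ h] := dP n; have [h' _ _ _] := dP (next n).
    by have [x' x'E _] := h x y (iffRL (h' x) dx) (esym yE); exists x'.
  have [_ _ _ h] := dP (next n).
  have [||x dx xE] := h 0 y; first exact: smem0.
    by rewrite linear0; apply: esym.
  by exists x; split=> //; exists 0; rewrite linear0 /= xE subrr.
Qed.
End Resolutions.

(** * Stalk complexes and Ext groups *)

Lemma dep_update (T : int -> Type) (z : forall n, T n) (c : int) (x : T c) :
  exists t : forall n, T n, t c = x /\ forall n, n != c -> t n = z n.
Proof.
have /dep_choice [t tE] : forall n, exists y : T n,
    (forall e : c = n, y = ecast m (T m) e x) /\ (n != c -> y = z n).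
  move=> n; have [e|ne] := eqVneq n c; last first.
    by exists (z n); split=> // e; rewrite e eqxx in ne.
  by subst n; exists x; split=> // e; rewrite eq_axiomK.
exists t; split=> [|n]; first by have [-> //] := tE c.
by have [_] := tE n.
Qed.

Section Stalks.
Variable R : pzRingType.

(* V in degree c. The term in degree n is the submodule of V that is zero unless
   n = c, so that no transport along n = c is needed. *)
Definition ustalk (c : int) (V : lmodType R) : ucx R.
Proof. by exists (fun n => csub V (n != c)) (fun n => \0). Defined.

Definition stalk (c : int) (V : lmodType R) (hV : fin_gen V) : bcomplex R.
Proof.
exists (fun n => csub V (n != c)) (fun n => \0) => //.
  by move=> n; apply: fin_gen_retract hV; apply: csub_retract.
by exists (absz c) => n cn x; apply: csub0; apply/eqP => e; rewrite e ltnn in cn.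
Defined.

Lemma csub_false (b : bool) (V : lmodType R) : ~~ b ->
  exists f : {linear V -> csub V b}, forall x, cval (f x) = x.
Proof.
move=> nb; have [x|f fE] := @corestrict _ _ _ (csub_submod V b) idfun.
  by move=> hb; rewrite hb in nb.
by exists f => x; rewrite /cval fE.
Qed.

Lemma stalk_map (Q : ucx R) (c : int) (V : lmodType R) (f : {linear Q c -> V}) :
  exists F : forall n, {linear Q n -> csub V (n != c)}, forall x, cval (F c x) = f x.
Proof.
have [|i iE] := @csub_false (c != c) V; first by rewrite eqxx.
have [F [FE _]] := @dep_update (fun n => {linear Q n -> csub V (n != c)}) (fun n => \0) c (i \o f).
by exists F => x; rewrite FE; apply: iE.
Qed.

(* H^{-(j+1)} of the complex Hom(Q, V) vanishes. *)
Definition coh0 (Q : ucx R) (V : lmodType R) (j : int) :=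
  forall f : {linear Q (next j) -> V}, (forall y, f (ud Q j y) = 0) ->
  exists g : {linear Q (next (next j)) -> V}, forall x, f x = g (ud Q (next j) x).

Lemma nullh_stalk (Q : ucx R) V j : nullh Q (ustalk (next j) V) -> coh0 Q V j.
Proof.
move=> n0 f fd; have [F FE] := stalk_map f.
have Fd n (x : Q n) : F (next n) (ud Q n x) = ud (ustalk (next j) V) n (F n x).
  have [e|ne] := eqVneq n j; last by rewrite [LHS]csub0 //; rewrite (inj_eq (addIr _)).
  by subst n; apply: cval_inj; rewrite FE fd !linear0.
have [h hE] := n0 (@UMap R Q (ustalk (next j) V) F Fd).
exists (cval \o h (next j)) => x.
have e : F (next j) x = h (next j) (ud Q (next j) x).
  by have := hE j x; rewrite /= subr0 add0r.
by rewrite -FE e.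
Qed.

Lemma coh0_retract Q V V' j : retract_of V' V -> coh0 Q V j -> coh0 Q V' j.
Proof.
move=> [i [r ri]] h f fd; have [|g gE] := h (i \o f).
  by move=> y; rewrite /= fd linear0.
by exists (r \o g) => x; rewrite /= -gE /= ri.
Qed.

Lemma coh0_rV Q n j : coh0 Q R^o j -> coh0 Q 'rV[R]_n j.
Proof.
move=> h f fd.
have pl i : linear (fun x : Q (next j) => f x 0 i : R^o).
  by move=> a x y; rewrite linearP !mxE.
have /choice [g gE] : forall i, exists g : {linear Q (next (next j)) -> R^o},
    forall x, mklin (pl i) x = g (ud Q (next j) x).
  by move=> i; apply: h => y; rewrite mklinE fd mxE.
have gl : linear (fun x => \row_i g i x).
  by move=> a x y; apply/rowP => i; rewrite !mxE linearP.
by exists (mklin gl) => x; rewrite mklinE; apply/rowP => i; rewrite mxE -gE.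
Qed.

Lemma fg_projective_retract V : projective V -> fin_gen V ->
  exists n, retract_of V 'rV[R]_n.
Proof.
move=> Vp /fin_gen_rV_surj [n [r rs]]; exists n.
have [i iE] := Vp _ _ r idfun rs.
by exists i, r.
Qed.

Lemma coh0_projective Q V j : projective V -> fin_gen V -> coh0 Q R^o j -> coh0 Q V j.
Proof.
move=> Vp Vf h; have [n Vn] := fg_projective_retract Vp Vf.
exact: coh0_retract Vn (@coh0_rV Q n j h).
Qed.

Lemma coh0_zero (Q : ucx R) (V : lmodType R) j : (forall x : V, x = 0) -> coh0 Q V j.
Proof. by move=> V0 f _; exists \0 => x; rewrite [LHS]V0. Qed.

(** The ascending counterpart of [null_homotopic]: what the homotopy built so far leaves of [f] is a
    cocycle with values in one term of [Y], and [coh0] factors it through the differential of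
    [Q]. *)
Lemma coh0_nullh (Q Y : ucx R) k : zero_below k Y ->
  (forall n, coh0 Q (Y (next n)) n) -> nullh Q Y.
Proof.
move=> Yk h f.
pose T n := {linear Q (next n) -> Y n}.
pose good n (h : T n) := forall x : Q n, f (next n) (ud Q n x) = ud Y n (h (ud Q n x)).
pose rel n (h : T n) (h' : T (next n)) := forall x : Q (next n),
  f (next n) x = ud Y n (h x) + h' (ud Q (next n) x).
(* In degree [k - 2] both [Y n] and [Y (next n)] are still zero, so the zero homotopy can start the
   ascent. *)
have [||n e _ ge|g [_ gE]] := @upward_choice T good rel (k - 2) (fun n => \0).
- by move=> x; rewrite /= linear0; apply: Yk; rewrite /next; lia.
- by move=> n nk x; rewrite /= linear0 addr0; apply: Yk; rewrite /next; lia.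
- have [|e' e'E] := h n (f (next n) \- (ud Y n \o e)); first by move=> y; rewrite /= ge subrr.
  have r : rel n e e' by move=> x; rewrite -e'E /= addrC subrK.
  exists e'; split=> // x; rewrite umd r linearD udd add0r //.
by exists g => n x; rewrite /= subr0; apply: gE.
Qed.

(** The extension is zero below degree [j + 1] and grows upward: the differential of [Y] after the
    last component is a cocycle with values in the next term, hence factors through the differential
    of [Q]. *)
Lemma extend_cocycle (Q Y : ucx R) j (f : {linear Q (next j) -> Y (next j)}) :
  (forall n, j <= n -> coh0 Q (Y (next (next n))) n) ->
  (forall y, f (ud Q j y) = 0) ->
  exists F : umap Q Y, forall x, F (next j) x = f x.
Proof.
move=> h fd.
pose T n := {linear Q (next n) -> Y (next n)}.
pose good n (F : T n) := forall y : Q n, ud Y (next n) (F (ud Q n y)) = 0.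
pose rel n (F : T n) (F' : T (next n)) := forall x : Q (next n),
  F' (ud Q (next n) x) = ud Y (next n) (F x).
have [t [tj tE]] := @dep_update T (fun n => \0) j f.
have [||n F jn gF|g [gt gE]] := @upward_choice T good rel j t.
- by move=> y; rewrite tj fd linear0.
- move=> n nj x; rewrite (tE n) /=; last by rewrite lt_eqF.
  rewrite linear0; have [e|ne] := eqVneq (next n) j; last by rewrite (tE _ ne).
  by subst j; rewrite tj fd.
- have [|F' F'E] := h n jn (ud Y (next n) \o F); first by move=> y; apply: gF.
  have r : rel n F F' by move=> x; rewrite -F'E.
  by exists F'; split=> // y; rewrite r udd.
pose G := unnext (T := fun n => {linear Q n -> Y n}) g.
have GE n : G (next n) = g n by rewrite /G unnextE.
have Gd : forall n (x : Q n), G (next n) (ud Q n x) = ud Y n (G n x).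
  by apply: unnext => n x; rewrite !GE; apply: gE.
by exists (UMap Gd) => x; rewrite /= GE gt // tj.
Qed.

(** Dimension shifting from [Y] to its term in degree [j + 1]: a cocycle extends to a chain map, and
    as [Y j] is zero, a null-homotopy of it reduces in degree [j + 1] to a factorization through the
    differential of [Q]. *)
Lemma nullh_coh0 (Q Y : ucx R) j : nullh Q Y -> (forall y : Y j, y = 0) ->
  (forall n, j <= n -> coh0 Q (Y (next (next n))) n) -> coh0 Q (Y (next j)) j.
Proof.
move=> n0 Y0 h f fd; have [F FE] := extend_cocycle h fd.
have [k kE] := n0 F; exists (k (next j)) => x.
by rewrite -FE; have := kE j x; rewrite /= subr0 [k j x]Y0 linear0 add0r.
Qed.

(* The projection of Q onto the boundaries in degree k - 1 is a cocycle; if it is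
   [g \o d], then g is a retraction of Q k onto the boundaries. *)
Lemma trunc_projective (Q : ucx R) j :
  uprojective Q -> coh0 Q (trunc Q (next (next j)) (next j)) j ->
  uprojective (trunc Q (next (next j))).
Proof.
set k := next (next j) => Qp h n.
have [nk|kn] := ltP n k; last by apply: projective_retract (Qp n); apply: trunc_retract.
have [e|ne] := eqVneq n (next j); last first.
  by apply: projective_zero => x; apply: trunc_low; move: nk ne; rewrite /k /next; lia.
subst n; have [|g gE] := h (trunc_proj Q k (next j)).
  move=> y; apply: trunc_val_inj; rewrite trunc_projE linear0 /trunc_fun udd.
  by rewrite ifF ?if_same //; rewrite /k /next; lia.
have vl : linear (fun w : trunc Q k (next j) => (trunc_val w).2) by move=> a x y; rewrite linearP.
apply: projective_retract (Qp k); exists (mklin vl), g => w.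
have [x <-] := trunc_proj_surj w.
by rewrite mklinE trunc_projE /trunc_fun /= lexx -gE.
Qed.
End Stalks.

(** * Resolutions of modules, indexed by the natural numbers *)

Section NatResolutions.
Variable R : pzRingType.

Lemma nat_choice (T : nat -> Type) (good : forall n, T n -> Prop)
    (rel : forall n, T n -> T n.+1 -> Prop) :
  (exists x, good 0%N x) ->
  (forall n x, good n x -> exists y, good n.+1 y /\ rel n x y) ->
  exists g : forall n, T n, good 0%N (g 0%N) /\ forall n, rel n (g n) (g n.+1).
Proof.
move=> /cid [x0 gx0] stepP.
pose T' n := {x : T n | good n x}.
pose step n (s : T' n) : T' n.+1 :=
  let c := cid (stepP n (sval s) (svalP s)) in exist _ (sval c) (proj1 (svalP c)).
pose fix G n : T' n := if n is m.+1 then step m (G m) else exist _ x0 gx0.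
exists (fun n => sval (G n)); split=> // n.
exact: (proj2 (svalP (cid (stepP n (sval (G n)) (svalP (G n)))))).
Qed.

Lemma nat_lift (M : lmodType R) (P P' : proj_resolution M) :
  exists phi : forall n, {linear P' n -> P n},
    (forall x, pr_aug P (phi 0%N x) = pr_aug P' x) /\
    forall n x, pr_diff P n (phi n.+1 x) = phi n (pr_diff P' n x).
Proof.
pose T n := {linear P' n -> P n}.
pose good n : T n -> Prop := match n return T n -> Prop with
  | 0%N => fun phi => forall x, pr_aug P (phi x) = pr_aug P' x
  | m.+1 => fun phi => forall x, pr_diff P m (phi (pr_diff P' m.+1 x)) = 0 end.
apply: (@nat_choice T good (fun n phi phi' =>
  forall x, pr_diff P n (phi' x) = phi (pr_diff P' n x))).
  have [phi phiE] := pr_proj (pr_aug P') (@pr_aug_surj _ _ P).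
  by exists phi.
move=> n phi gphi.
have [x|phi' phi'E] := @proj_lift _ _ _ _ (pr_diff P n) (phi \o pr_diff P' n) (@pr_proj _ _ P' n.+1).
  case: n phi gphi x => [|n] phi gphi x /=.
    by apply/pr_exact0; rewrite gphi; apply/pr_exact0; exists x.
  by apply/pr_exact; rewrite gphi.
exists phi'; split=> // x.
by rewrite phi'E /=; have /pr_exact -> : exists y, pr_diff P' n.+1 y = pr_diff P' n.+1 x
  by [exists x]; rewrite linear0.
Qed.

Lemma nat_homotopy (M : lmodType R) (P : proj_resolution M)
    (psi : forall n, {linear P n -> P n}) :
  (forall x, pr_aug P (psi 0%N x) = pr_aug P x) ->
  (forall n x, pr_diff P n (psi n.+1 x) = psi n (pr_diff P n x)) ->
  exists h : forall n, {linear P n -> P n.+1},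
    forall n x, x - psi n.+1 x = pr_diff P n.+1 (h n.+1 x) + h n (pr_diff P n x).
Proof.
move=> psi0 psid.
have dd n x : pr_diff P n (pr_diff P n.+1 x) = 0 by apply/pr_exact; exists x.
pose T n := {linear P n -> P n.+1}.
pose good n (h : T n) := forall x,
  pr_diff P n (h (pr_diff P n x)) = pr_diff P n x - psi n (pr_diff P n x).
have [| |h [_ hE]] := @nat_choice T good (fun n h h' =>
  forall x, x - psi n.+1 x = pr_diff P n.+1 (h' x) + h (pr_diff P n x)).
- have [x|h hE] := @proj_lift _ _ _ _ (pr_diff P 0) (idfun \- psi 0%N) (@pr_proj _ _ P 0%N).
    by apply/pr_exact0; rewrite /= linearB psi0 subrr.
  by exists h => x; rewrite hE.
- move=> n h gh.
  have [x|h' h'E] := @proj_lift _ _ _ _ (pr_diff P n.+1)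
      ((idfun \- psi n.+1) \- (h \o pr_diff P n)) (@pr_proj _ _ P n.+1).
    by apply/pr_exact; rewrite /= !linearB gh psid subrr.
  have r x : x - psi n.+1 x = pr_diff P n.+1 (h' x) + h (pr_diff P n x).
    by rewrite h'E /= subrK.
  by exists h'; split=> // x; rewrite r dd linear0 addr0.
by exists h.
Qed.

Definition ext_zero (M V : lmodType R) (P : proj_resolution M) (i : nat) :=
  forall f : {linear P i -> V}, ext_cocycle f -> ext_coboundary f.

(** With [phi] and [psi] comparing the resolutions, [f] differs from [f psi phi] by [f] applied to a
    homotopy term; since [f] is a cocycle, only the part that factors through the differential
    survives. *)
Lemma ext_zero_any (M V : lmodType R) (P P' : proj_resolution M) (i : nat) :
  ext_zero V P i.+1 -> ext_zero V P' i.+1.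
Proof.
move=> h f fd; have [phi [phi0 phid]] := nat_lift P P'.
have [psi [psi0 psid]] := nat_lift P' P.
have [||k kE] := @nat_homotopy M P' (fun n => psi n \o phi n).
- by move=> x /=; rewrite psi0 phi0.
- by move=> n x /=; rewrite psid phid.
have [y|g gE] := h (f \o psi i.+1); first by rewrite /= -psid fd.
exists ((g \o phi i) \+ (f \o k i)) => x /=.
rewrite -phid -gE /= -linearD -[in RHS](addr0 (psi _ _)); apply/eqP.
rewrite -subr_eq0 -linearB addr0 opprD addrA kE addrK; apply/eqP; exact: fd.
Qed.

(** [next (idx m.+1)] and [idx m] agree only up to a proof. The lemmas on casts let the degrees be
    variables, so that the equalities can be eliminated. *)
Definition cast_lin (Q : int -> lmodType R) (m n : int) (e : m = n) : {linear Q m -> Q n} :=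
  ecast k {linear Q m -> Q k} e idfun.

Lemma cast_exact (Q : ucx R) i n p (e : next i = n) (e' : next n = p) :
  exact_at Q i -> forall x : Q n, cast_lin Q e' (ud Q n x) = 0 <->
    exists y, cast_lin Q e (ud Q i y) = x.
Proof.
case: n / e e' => e'; case: p / e' => Qi x; split; first exact: Qi.
by move=> [y <-]; apply: udd.
Qed.

Lemma cast_coh0 (Q : ucx R) V i n p (e : next i = n) (e' : next n = p) :
  coh0 Q V i <->
  forall f : {linear Q n -> V}, (forall y, f (cast_lin Q e (ud Q i y)) = 0) ->
    exists g : {linear Q p -> V}, forall x, f x = g (cast_lin Q e' (ud Q n x)).
Proof. by case: n / e e' => e'; case: p / e'. Qed.

(** The term of index [m] is [Q (idx m)]. The last clause is shifted by one because [coh0] in degree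
    [j] is about maps out of [Q (next j)]. *)
Lemma nat_resolution (Q : ucx R) (idx : nat -> int) (M : lmodType R)
    (e : forall m, next (idx m.+1) = idx m) (aug : {linear Q (idx 0%N) -> M}) :
  (forall m, projective (Q (idx m))) ->
  (forall y, exists x, aug x = y) ->
  (forall x, aug x = 0 <-> exists y, cast_lin Q (e 0%N) (ud Q _ y) = x) ->
  (forall m, exact_at Q (idx m.+2)) ->
  exists P : proj_resolution M,
    (forall m, (forall x : Q (idx m), x = 0) -> forall x : P m, x = 0) /\
    forall V m, ext_zero V P m.+1 <-> coh0 Q V (idx m.+2).
Proof.
move=> Qp aug_surj aug0 Qe.
pose D m : {linear Q (idx m.+1) -> Q (idx m)} := cast_lin Q (e m) \o ud Q (idx m.+1).
exists (@ProjResolution R M (fun m => Q (idx m)) D aug Qp aug_surj aug0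
  (fun m => cast_exact (e m.+1) (e m) (Qe m))); split=> // V m.
by have [h1 h2] := @cast_coh0 Q V _ _ _ (e m.+1) (e m); split=> h; [apply: h2 | apply: h1].
Qed.
End NatResolutions.

(** * Isomorphisms, shifts and cohomology in the derived category *)

Notation shiftn i X := (iter i (@shift _) X).

Section Isomorphic.
Variable C : category.

Definition isomorphic (X Y : C) := exists f : hom X Y, is_iso f.

Lemma isomorphic_refl X : isomorphic X X.
Proof. by exists (idm X), (idm X); split; apply: comp_idl. Qed.

Lemma isomorphic_sym X Y : isomorphic X Y -> isomorphic Y X.
Proof. by move=> [f [g [gf fg]]]; exists g, f. Qed.

Lemma comp_cancel (X Y Z : C) (f : hom Y Z) (g : hom X Y) (f' : hom Z Y) (g' : hom Y X) :
  heq (comp f' f) (idm Y) -> heq (comp g' g) (idm X) ->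
  heq (comp (comp g' f') (comp f g)) (idm X).
Proof.
move=> ff gg; apply: heq_trans (heq_sym (compA _ _ _)) _; apply: heq_trans gg.
apply: comp_heq (heq_refl _) _; apply: heq_trans (compA _ _ _) _.
by apply: heq_trans (comp_heq ff (heq_refl _)) _; apply: comp_idl.
Qed.

Lemma isomorphic_trans X Y Z : isomorphic X Y -> isomorphic Y Z -> isomorphic X Z.
Proof.
move=> [f [g [gf fg]]] [f' [g' [gf' fg']]].
by exists (comp f' f), (comp g g'); split; apply: comp_cancel.
Qed.

(** In [Db_cat], where zero maps exist, this says Hom(X, Y) = 0. *)
Definition at_most_one (X Y : C) := forall u v : hom X Y, heq u v.

Lemma at_most_one_iso (X Y X' Y' : C) : isomorphic X X' -> isomorphic Y Y' ->
  at_most_one X Y -> at_most_one X' Y'.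
Proof.
move=> [a [a' [_ aa']]] [b [b' [_ bb']]] h u v.
have e w : heq w (comp (comp b (comp (comp b' w) a)) a').
  apply: heq_sym; apply: heq_trans (heq_sym (compA _ _ _)) _.
  apply: heq_trans (comp_heq (heq_refl _) (heq_sym (compA _ _ _))) _.
  apply: heq_trans (comp_heq (heq_refl _) (comp_heq (heq_refl _) aa')) _.
  apply: heq_trans (comp_heq (heq_refl _) (comp_idr _)) _.
  apply: heq_trans (compA _ _ _) _.
  by apply: heq_trans (comp_heq bb' (heq_refl _)) _; apply: comp_idl.
apply: heq_trans (e u) _; apply: heq_trans (heq_sym (e v)).
by apply: comp_heq (comp_heq (heq_refl _) (h _ _)) (heq_refl _).
Qed.
End Isomorphic.

Lemma fmap_isomorphic (C D : category) (F : functor C D) (X Y : C) :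
  isomorphic X Y -> isomorphic (F X) (F Y).
Proof.
move=> [f [g [gf fg]]]; exists (fmap F f), (fmap F g); split.
  by apply: heq_trans (heq_sym (fmap_comp _ _ _)) _; apply: heq_trans (fmap_heq F gf) (fmap_id F _).
by apply: heq_trans (heq_sym (fmap_comp _ _ _)) _; apply: heq_trans (fmap_heq F fg) (fmap_id F _).
Qed.

Section Equivalence.
Variables (C D : category) (F : functor C D) (G : functor D C).
Variable eta : nat_iso (functor_comp G F) (functor_id C).

Lemma nat_iso_faithful X Y (u v : hom X Y) : heq (fmap F u) (fmap F v) -> heq u v.
Proof.
move=> Fuv; have [a [_ ea]] := nt_iso eta X.
have e w : heq w (comp (comp (eta Y) (fmap G (fmap F w))) a).
  apply: heq_trans (comp_heq (nt_natural eta w) (heq_refl a)).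
  apply: heq_trans (compA _ _ _); apply: heq_trans (heq_sym (comp_idr _)) _.
  exact: comp_heq (heq_refl _) (heq_sym ea).
apply: heq_trans (e u) _; apply: heq_trans (heq_sym (e v)).
exact: comp_heq (comp_heq (heq_refl _) (fmap_heq G Fuv)) (heq_refl _).
Qed.

Lemma nat_iso_isomorphic X : isomorphic (G (F X)) X.
Proof. by exists (nt eta X); exact: (nt_iso eta X). Qed.
End Equivalence.

Lemma equivalence_at_most_one (C D : category) (F : functor C D) : is_equivalence F ->
  forall X Y, at_most_one X Y <-> at_most_one (F X) (F Y).
Proof.
move=> [G [[eta] [eps]]] X Y; split=> h u v; last exact: (nat_iso_faithful eta).
apply: (nat_iso_faithful eps); move: (fmap G u) (fmap G v).
by apply: at_most_one_iso h; apply: isomorphic_sym; apply: (nat_iso_isomorphic eta).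
Qed.

Section DerivedCategory.
Variable R : pzRingType.
Implicit Types X Y : bcomplex R.

Definition db_iso X Y := @isomorphic (Db_cat R) X Y.

Lemma db_iso_hom0 X Y X' Y' : db_iso X X' -> db_iso Y Y' -> hom0 X Y -> hom0 X' Y'.
Proof. exact: (@at_most_one_iso (Db_cat R)). Qed.

Lemma db_iso_quasi_iso X Y (s : cmap X Y) : quasi_iso s -> db_iso X Y.
Proof.
move=> qs; exists (zz_map s), (zz_inv qs); split; [exact: zz_inv_l | exact: zz_inv_r].
Qed.

Lemma db_iso_shift X Y : db_iso X Y -> db_iso (shift X) (shift Y).
Proof. exact: (@fmap_isomorphic _ _ (Db_shift R)). Qed.

Lemma db_iso_shiftn i X Y : db_iso X Y -> db_iso (shiftn i X) (shiftn i Y).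
Proof. by move=> h; elim: i => //= i; apply: db_iso_shift. Qed.

Lemma shiftn_term i X n : shiftn i X n = X (n + i%:Z) :> lmodType R.
Proof.
elim: i n => [|i IHi] n; first by rewrite addr0.
by rewrite [LHS](IHi (next n)); congr (cx X _); rewrite /next; lia.
Qed.

(* The cohomology of X vanishes in degrees > c, resp. <= c. *)
Definition coh_le (c : int) X := forall n, c <= n -> exact_at (ubc X) n.
Definition coh_gt (c : int) X := forall n, next n <= c -> exact_at (ubc X) n.

Lemma coh_le_shift c X : coh_le c X -> coh_le (c - 1) (shift X).
Proof.
move=> h n cn x; rewrite /= => /eqP; rewrite oppr_eq0 => /eqP dx.
have [|y yE] := h (next n) _ x dx; first by rewrite /next; lia.
by exists (- y); rewrite linearN opprK.
Qed.

Lemma coh_le_shiftn i c X : coh_le c X -> coh_le (c - i%:Z) (shiftn i X).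
Proof.
move=> h; elim: i => [|i IHi]; first by rewrite subr0.
have -> : c - i.+1%:Z = c - i%:Z - 1 by lia.
exact: coh_le_shift.
Qed.

Lemma coh_le_mono c c' X : c <= c' -> coh_le c X -> coh_le c' X.
Proof. by move=> cc h n cn; apply: h; apply: le_trans cn. Qed.

Lemma coh_le_exists X : exists c : nat, coh_le c%:Z X.
Proof.
have [N NX] := cx_bounded X; exists N => n Nn x _.
exists 0; rewrite linear0 [RHS](NX (next n)) //; rewrite /next; lia.
Qed.

Lemma csub_cast (V : lmodType R) (b b' : bool) : b = b' ->
  exists f : {linear csub V b -> csub V b'}, forall x, cval (f x) = cval x.
Proof. by move=> <-; exists idfun. Qed.

Lemma shift_stalk c V (hV : fin_gen V) : db_iso (shift (stalk c hV)) (stalk (c - 1) hV).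
Proof.
have bE n : (next n != c) = (n != c - 1) by rewrite /next; congr (~~ _); lia.
have /dep_choice [f fE] := fun n => @csub_cast V _ _ (bE n).
have /dep_choice [g gE] := fun n => @csub_cast V _ _ (esym (bE n)).
have fd n x : f (next n) (cx_d (shift (stalk c hV)) n x) = cx_d (stalk (c - 1) hV) n (f n x).
  by rewrite /= oppr0 linear0.
apply: (@db_iso_quasi_iso _ _ (@CMap R (shift (stalk c hV)) (stalk (c - 1) hV) f fd)) => n; split=> [x _ [y /= fx]|y _].
  exists 0; rewrite linear0; apply: cval_inj; rewrite linear0.
  by rewrite -fE -fx linear0.
exists (g (next n) y); split; first by rewrite /= oppr0.
exists 0; rewrite linear0; apply: cval_inj.
by rewrite linear0 linearB /= [X in X - _]fE gE subrr.
Qed.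

Lemma shiftn_stalk i c V (hV : fin_gen V) :
  db_iso (shiftn i (stalk c hV)) (stalk (c - i%:Z) hV).
Proof.
elim: i => [|i IHi]; first by rewrite subr0; apply: isomorphic_refl.
have -> : c - i.+1%:Z = c - i%:Z - 1 by lia.
by apply: isomorphic_trans (shift_stalk _ _); apply: db_iso_shift.
Qed.

Lemma coh_le_stalk c V (hV : fin_gen V) : coh_le c (stalk c hV).
Proof.
move=> n cn x _; exists 0; rewrite linear0; apply: esym; apply: csub0.
by rewrite gt_eqF //; move: cn; rewrite /next; lia.
Qed.

Lemma uqi_id (X : ucx R) : uqi (umap_id X).
Proof.
move=> n; split=> [x _ [y yE]|y dy]; first by exists y.
by exists y; split=> //; exists 0; rewrite linear0 /= subrr.
Qed.

Let Rfg := fin_gen_reg R.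

Lemma hom0_stalk_reg c Y : hom0 (stalk c Rfg) Y <-> nullh (ustalk c R^o) (ubc Y).
Proof.
apply: (@hom0_nullh _ (ubc (stalk c Rfg))); last exact: (@uqi_id (ubc (stalk c Rfg))).
- exact: bc_bounded_above.
- exact: cx_fg.
- by move=> n; apply: projective_retract (@projective_reg R); apply: csub_retract.
Qed.

(** A cycle [e] is the image of 1 under a chain map from [R] placed in its degree; a null-homotopy
    of that map exhibits [e] as a boundary. *)
Lemma hom0_stalk_exact n Y : hom0 (stalk (next n) Rfg) Y -> exact_at (ubc Y) n.
Proof.
move=> /hom0_stalk_reg n0 e de.
have fl : linear (fun s : csub (R^o : lmodType R) (next n != next n) => (cval s : R) *: e).
  by move=> a x y; rewrite linearP scalerDl scalerA.
have [F [Fn F0]] := @dep_update (fun m => {linear csub (R^o : lmodType R) (m != next n) -> Y m})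
  (fun m => \0) (next n) (mklin fl).
have Fd m (s : ustalk (next n) R^o m) : F (next m) (ud _ m s) = ud (ubc Y) m (F m s).
  rewrite linear0; have [em|/eqP ne] := EM (m = next n); last by rewrite F0 // linear0.
  by subst m; rewrite Fn mklinE linearZ /= de scaler0.
have [h hE] := n0 (@UMap R (ustalk (next n) R^o) (ubc Y) F Fd).
have [|s sE] := @cval_mk R R^o (next n != next n) 1; first by rewrite eqxx.
exists (h n s); have := hE n s; rewrite /= subr0 linear0 addr0 => <-.
by rewrite Fn mklinE sE scale1r.
Qed.

(** * Truncations and orthogonality *)

Section Noetherian.
Hypothesis noeth : left_noetherian R.

Section LowTruncation.
Variables (c : int) (X : bcomplex R).

(** The good truncation tau_{<= c}, as a subcomplex. *)
Definition low_mem n (x : X n) : Prop := (c <= n -> cx_d X n x = 0) /\ (c < n -> x = 0).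
Lemma low_mem0 n : low_mem (0 : X n). Proof. by split=> // _; rewrite linear0. Qed.
Lemma low_memP n a (x y : X n) : low_mem x -> low_mem y -> low_mem (a *: x + y).
Proof.
move=> [x1 x2] [y1 y2]; split=> h; first by rewrite linearP x1 // y1 // scaler0 addr0.
by rewrite x2 // y2 // scaler0 addr0.
Qed.
Definition low_sub n := Submodule (@low_mem0 n) (@low_memP n).

Lemma low_d_proof n : exists d : {linear sub_of (low_sub n) -> sub_of (low_sub (next n))},
  forall x, sub_val _ (d x) = cx_d X n (sub_val _ x).
Proof.
have [x|d dE] := @corestrict _ _ _ (low_sub (next n)) (cx_d X n \o sub_val (low_sub n)).
  have [h _] := sub_valP x; split=> hn /=; first exact: cx_dd.
  by apply: h; move: hn; rewrite /next; lia.
by exists d.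
Qed.

Definition low_trunc : bcomplex R.
Proof.
exists (fun n => sub_of (low_sub n)) (fun n => sval (cid (low_d_proof n))).
- by move=> n x; apply: sub_val_inj; rewrite !(svalP (cid (low_d_proof _))) cx_dd linear0.
- by move=> n; apply: fin_gen_sub => //; apply: cx_fg.
- have [N NX] := cx_bounded X; exists N => n Nn x.
  by apply: sub_val_inj; rewrite linear0 [LHS](NX n Nn).
Defined.

Lemma low_trunc_val n x : sub_val _ (cx_d low_trunc n x) = cx_d X n (sub_val _ x).
Proof. exact: (svalP (cid (low_d_proof n)) x). Qed.

Definition low_in : cmap low_trunc X :=
  @CMap R low_trunc X (fun n => sub_val (low_sub n)) low_trunc_val.

Lemma low_trunc_zero n : c < n -> forall x : low_trunc n, x = 0.
Proof.
move=> cn x; apply: sub_val_inj; rewrite linear0.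
by have [_ h] := sub_valP x; apply: h.
Qed.

Lemma low_in_qi : coh_le c X -> quasi_iso low_in.
Proof.
move=> h n; split=> [x dx [y yE]|y dy].
  have [nc|cn] := leP (next n) c; last first.
    by exists 0; rewrite linear0 [RHS]low_trunc_zero.
  have [|y' y'E] := @sub_val_mk _ _ (low_sub n) y.
    by split=> hn; move: nc hn; rewrite /next; lia.
  by exists y'; apply: sub_val_inj; rewrite low_trunc_val y'E.
have [nc|cn] := leP (next n) c.
  have [|x xE] := @sub_val_mk _ _ (low_sub (next n)) y.
    by split=> hn //; move: nc hn; rewrite /next; lia.
  exists x; split; first by apply: sub_val_inj; rewrite low_trunc_val xE linear0.
  by exists 0; rewrite linear0 [low_in _ _]xE subrr.
have [|y' y'E] := h n _ y dy; first by move: cn; rewrite /next; lia.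
by exists 0; rewrite !linear0; split=> //; exists (- y'); rewrite linearN y'E sub0r.
Qed.
End LowTruncation.

Lemma hom0_coh c X Y : coh_le c X -> coh_gt c Y -> hom0 X Y.
Proof.
move=> /low_in_qi /db_iso_quasi_iso Xi Yc.
apply: (db_iso_hom0 Xi (isomorphic_refl _)).
have [Q [q [Qp Qf Qc qq]]] := resolution_exists noeth (@low_trunc_zero c X).
have Qb : bounded_above Q by exists c.
apply/(hom0_nullh Qb Qf Qp Y qq) => f; apply: null_homotopic => // n.
by have [nc|cn] := leP (next n) c; [right; apply: Yc | left; apply: Qc].
Qed.

Lemma resolution X : exists (Q : ucx R) (q : umap Q (ubc X)),
  [/\ uprojective Q, fg_terms Q, bounded_above Q & uqi q].
Proof.
have [b bX] := bc_bounded_above X.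
have [Q [q [Qp Qf Qc qq]]] := resolution_exists noeth bX.
by exists Q, q; split=> //; exists b.
Qed.

Definition high_trunc c X : bcomplex R := btrunc (bc_bounded_above X) (@cx_fg R X) (next c).

Lemma high_trunc_gt c X : coh_gt c (high_trunc c X).
Proof. by move=> n nc; apply: (@trunc_exact_low R (ubc X)); move: nc; rewrite /next; lia. Qed.

(** Only the projection onto the truncation is tested. A cycle of degree above [c] comes, up to a
    boundary, from a cycle of [Q]; the null-homotopy makes its image a boundary in the truncation,
    which agrees with [X] in these degrees. *)
Lemma hom0_high_trunc c X : hom0 X (high_trunc c X) -> coh_le c X.
Proof.
have [Q [q [Qp Qf Qb qq]]] := resolution X.
move=> /(hom0_nullh Qb Qf Qp _ qq) n0 n cn a da.
have [h hE] := n0 (umap_comp (trunc_proj (ubc X) (next c)) q).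
have [x [dx [y yE]]] := (qq n).2 a da.
have [z zE] := trunc_proj_surj (h n x).
have e : trunc_proj (ubc X) (next c) (next n) (q (next n) x) =
    ud (trunc (ubc X) (next c)) n (trunc_proj (ubc X) (next c) n z).
  have := hE n x; rewrite dx [h (next n) 0]linear0 addr0 zE => <-.
  by rewrite subr0.
have qx := trunc_proj_d _ e.
exists (z - y); rewrite linearB -qx; last by move: cn; rewrite /next; lia.
by rewrite -yE opprB addrC subrK.
Qed.
End Noetherian.
End DerivedCategory.

(** * Perfect complexes *)

Section Perfect.
Variable R : pzRingType.
Hypothesis noeth : left_noetherian R.
Implicit Types X Y : bcomplex R.

Definition perfect X := exists N : nat, forall i Y, (N <= i)%N -> coh_le 0 Y ->
  hom0 X (shiftn i Y).

Lemma perfect_coh0 X (Q : ucx R) (q : umap Q (ubc X)) :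
  uprojective Q -> fg_terms Q -> bounded_above Q -> uqi q -> perfect X ->
  exists j0 : int, forall j (V : lmodType R), j <= j0 -> fin_gen V -> coh0 Q V j.
Proof.
move=> Qp Qf Qb qq [N XN]; exists (- N%:Z - 1) => j V jN Vf.
apply: nullh_stalk; have := XN (absz (next j)) (stalk 0 Vf).
move=> /(_ _ (@coh_le_stalk _ 0 V Vf)) h.
have {}h : hom0 X (stalk (next j) Vf).
  have -> : next j = 0 - (absz (next j))%:Z by move: jN; rewrite /next; lia.
  apply: db_iso_hom0 (isomorphic_refl _) (shiftn_stalk _ _ _) (h _).
  by move: jN; rewrite /next; lia.
exact: (iffLR (hom0_nullh Qb Qf Qp _ qq) h).
Qed.

Lemma coh0_perfect X (Q : ucx R) (q : umap Q (ubc X)) (j0 : int) :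
  uprojective Q -> fg_terms Q -> bounded_above Q -> uqi q ->
  (forall j (V : lmodType R), j <= j0 -> fin_gen V -> coh0 Q V j) -> perfect X.
Proof.
move=> Qp Qf Qb qq h; have [k0 Xk0] := bc_zero_below X.
(* [j <= j0] makes the lowest term of the truncation projective; [k = j + 2 <= k0] keeps [X] zero
   below [k], so that [q] factors. *)
pose j := Num.min j0 (k0 - 2); pose k := next (next j).
have Xk : zero_below k (ubc X) by apply: Xk0; rewrite /k /j /next; lia.
pose W := btrunc Qb Qf k.
have Wp : uprojective (ubc W).
  apply: trunc_projective => //; apply: h; first by rewrite /j; lia.
  exact: (@cx_fg R W).
(* [W] starts in degree [k - 1] and [Y[i]] is exact in degrees above [-i], so for these [i] all
   nonzero terms of [W] face the exact range. *)
exists (absz k).+2 => i Y ki Y0.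
have Wq : uqi (ubm (bfactor Qb Qf Xk q)) by exact: (factor_uqi Xk qq).
apply/(hom0_nullh (bc_bounded_above W) (@cx_fg R W) Wp _ Wq) => f.
apply: null_homotopic => //; first exact: bc_bounded_above.
move=> n; have [nk|kn] := ltP (next (next n)) k.
  by left=> x; apply: (@trunc_low R Q k).
right; apply: (coh_le_shiftn (i := i) Y0); move: kn ki; rewrite /next; lia.
Qed.

Lemma perfect_reg : perfect (stalk 0 (fin_gen_reg R)).
Proof.
exists 1%N => i Y i1 Y0; apply/hom0_stalk_reg => f.
apply: null_homotopic.
- by move=> n; apply: projective_retract (@projective_reg R); apply: csub_retract.
- exact: (bc_bounded_above (stalk 0 (fin_gen_reg R))).
move=> n; have [e|ne] := EM (next n = 0); last by left=> x; apply: csub0; apply/eqP.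
right; apply: (coh_le_shiftn (i := i) Y0); move: e i1; rewrite /next; lia.
Qed.

(** Vanishing of Ext into the ring passes to Ext into [T]: its model [W] has finitely generated
    projective terms, retracts of free modules, and [coh0_nullh] treats them one at a time. *)
Lemma perfect_nullh (Q : ucx R) (j0 : int) T : perfect T ->
  (forall j, j <= j0 -> coh0 Q R^o j) ->
  exists W, db_iso W T /\ exists N : nat, forall i, (N <= i)%N -> nullh Q (ubc (shiftn i W)).
Proof.
move=> Tp h; have [P [p [Pp Pf Pb pp]]] := resolution noeth T.
have [j1 j1P] := perfect_coh0 Pp Pf Pb pp Tp.
have [k0 Tk0] := bc_zero_below T.
pose j := Num.min j1 (k0 - 2); pose k := next (next j).
have Tk : zero_below k (ubc T) by apply: Tk0; rewrite /k /j /next; lia.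
pose W := btrunc Pb Pf k; exists W; split.
  apply: (@db_iso_quasi_iso _ _ _ (bfactor Pb Pf Tk p)).
  exact: (factor_uqi Tk pp).
have Wp : uprojective (ubc W).
  apply: trunc_projective => //; apply: j1P; first by rewrite /j; lia.
  exact: (@cx_fg R W).
have [b Wb] := bc_bounded_above W.
(* [W[i]] in degree [n + 1] is [W] in degree [n + 1 + i]: zero beyond [b], and otherwise
   [n <= j0]. *)
exists (absz b + absz j0).+1 => i iN.
have [k1 Wk1] := bc_zero_below (shiftn i W).
apply: (@coh0_nullh _ _ _ k1); first exact: Wk1.
move=> n; have e := shiftn_term i W (next n).
rewrite /= e; have [bn|nb] := ltP b (next n + i%:Z); first by apply: coh0_zero; apply: Wb.
apply: coh0_projective; [exact: Wp | exact: cx_fg | apply: h].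
by move: nb iN; rewrite /next; lia.
Qed.
End Perfect.

(* What the argument uses of an equivalence: a relation closed under converse, and
   of the Hom sets only whether they vanish. *)
Record correspondence (R S : pzRingType) := Correspondence {
  cor :> bcomplex R -> bcomplex S -> Prop;
  cor_l : forall X, exists Y, cor X Y;
  cor_r : forall Y, exists X, cor X Y;
  cor_hom0 : forall X Y X' Y', cor X Y -> cor X' Y' -> hom0 X X' <-> hom0 Y Y';
  cor_shift : forall X Y, cor X Y -> cor (shift X) (shift Y) }.

Definition cor_sym (R S : pzRingType) (c : correspondence R S) : correspondence S R :=
  @Correspondence S R (fun Y X => c X Y) (cor_r c) (cor_l c)
    (fun Y X Y' X' h h' => iff_sym (cor_hom0 h h')) (fun Y X h => cor_shift h).

Lemma derived_equivalent_cor (R S : pzRingType) : derived_equivalent R S ->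
  inhabited (correspondence R S).
Proof.
move=> [F [phi [_ eqF]]]; split.
pose c (X : bcomplex R) (Y : bcomplex S) := db_iso (F X : bcomplex S) Y.
apply: (@Correspondence R S c).
- by move=> X; exists (F X); apply: isomorphic_refl.
- by move=> Y; have [G [_ [eps]]] := eqF; exists (G Y); apply: (nat_iso_isomorphic eps).
- move=> X Y X' Y' XY XY'; apply: iff_trans (equivalence_at_most_one eqF X X') _.
  split; first exact: db_iso_hom0.
  by apply: db_iso_hom0; apply: isomorphic_sym.
- move=> X Y XY; apply: isomorphic_trans (db_iso_shift XY).
by exists (nt phi X); exact: (nt_iso phi X).
Qed.

Section Transport.
Variables (R S : pzRingType) (noethR : left_noetherian R) (noethS : left_noetherian S).
Variable rho : correspondence R S.

Lemma cor_shiftn i X Y : rho X Y -> rho (shiftn i X) (shiftn i Y).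
Proof. by move=> h; elim: i => //= i; apply: cor_shift. Qed.

(* D^{<= 0} over S is the left orthogonal of the right orthogonal of the objects
   S[i], i >= 0, so it suffices to bound the object U corresponding to S. *)
Lemma cor_coh_le : exists c : nat, forall X Y, rho X Y -> coh_le 0 Y -> coh_le c%:Z X.
Proof.
have [U US] := cor_r rho (stalk 0 (fin_gen_reg S)).
have [c Uc] := coh_le_exists U; exists c => X Y XY Y0.
have [E WE] := cor_l rho (high_trunc c X).
apply: (hom0_high_trunc noethR); apply/(cor_hom0 XY WE).
(* It remains that [E] has no cohomology in degrees [<= 0]. It is tested by maps from shifts of [S];
   these correspond to shifts of [U], whose cohomology in degrees [<= c] makes them orthogonal to
   the truncation. *)
apply: (hom0_coh noethS Y0) => n n0; apply: hom0_stalk_exact.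
have -> : next n = 0 - (absz (next n))%:Z by lia.
apply: db_iso_hom0 (shiftn_stalk _ _ _) (isomorphic_refl _) _.
apply/(cor_hom0 (cor_shiftn (absz (next n)) US) WE).
apply: (hom0_coh noethR _ (@high_trunc_gt R c X)).
have h : c%:Z - (absz (next n))%:Z <= c%:Z by lia.
exact: (coh_le_mono h (coh_le_shiftn (i := absz (next n)) Uc)).
Qed.

Lemma cor_perfect X Y : rho X Y -> perfect X -> perfect Y.
Proof.
move=> XY [N XN]; have [c cP] := cor_coh_le.
exists (N + c)%N => i Z iN Z0; have [Z' ZZ'] := cor_r rho Z.
apply/(cor_hom0 XY (cor_shiftn i ZZ')).
(* [c] of the shifts bring [Z'] into degrees [<= 0]; at least [N] are left. *)
have -> : i = (i - c + c)%N by lia.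
rewrite iterD; apply: XN; first by lia.
by rewrite -(subrr c%:Z); apply: coh_le_shiftn; apply: cP ZZ' Z0.
Qed.
End Transport.

(** * The conjecture *)

Section StalkResolution.
Variable R : pzRingType.

Lemma cast_um (X Y : ucx R) (f : umap X Y) m n (e : m = n) x :
  f n (cast_lin X e x) = cast_lin Y e (f m x).
Proof. by case: n / e. Qed.

Lemma uqi_surj_cast (X Y : ucx R) (f : umap X Y) n m (e : next n = m) : uqi f ->
  forall y : Y m, ud Y m y = 0 ->
  exists x : X m, ud X m x = 0 /\ exists y', f m x - y = cast_lin Y e (ud Y n y').
Proof. by move=> qf; case: m / e => y dy; apply: (qf n).2. Qed.

Lemma uqi_inj_cast (X Y : ucx R) (f : umap X Y) n m (e : next n = m) : uqi f ->
  forall x : X m, ud X m x = 0 -> (exists y, cast_lin Y e (ud Y n y) = f m x) ->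
  exists x', cast_lin X e (ud X n x') = x.
Proof. by move=> qf; case: m / e => x dx; apply: (qf n).1. Qed.

Lemma uqi_exact (X Y : ucx R) (f : umap X Y) n : uqi f ->
  (forall y : Y (next n), y = 0) -> exact_at X n.
Proof. by move=> qf Y0 x dx; apply: (qf n).1 => //; exists 0; rewrite linear0 [RHS]Y0. Qed.

Lemma stalk_nat_resolution (M : lmodType R) (Q : ucx R) (q : umap Q (ustalk 0 M)) :
  uprojective Q -> (forall n, 0 < n -> forall x : Q n, x = 0) -> uqi q ->
  exists P : proj_resolution M,
    (forall m : nat, (forall x : Q (- m%:Z), x = 0) -> forall x : P m, x = 0) /\
    forall V m, ext_zero V P m.+1 <-> coh0 Q V (- m.+2%:Z).
Proof.
move=> Qp Q0 qq.
pose idx (m : nat) := - m%:Z.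
have e m : next (idx m.+1) = idx m by rewrite /next /idx; lia.
have Qd (x : Q (idx 0%N)) : ud Q _ x = 0 by apply: Q0.
pose aug : {linear Q (idx 0%N) -> M} := cval \o q (idx 0%N).
apply: (@nat_resolution R Q idx M e aug) => [m|y|x|m].
- exact: Qp.
- have [|z zE] := @cval_mk R M (idx 0%N != 0) y; first by rewrite eqxx.
  have [|x [_ [y' y'E]]] := @uqi_surj_cast _ _ q _ _ (e 0%N) qq z; first by [].
  exists x; rewrite /aug /= -[RHS]zE; congr (cval _); apply/eqP.
  by rewrite -subr_eq0 y'E /= linear0.
- split=> [/= qx|[y <-]]; last first.
    transitivity (cval (cast_lin (ustalk 0 M) (e 0%N) 0)); last by rewrite !linear0.
    by rewrite -[in RHS](umd q y : _ = 0) -cast_um.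
  apply: (uqi_inj_cast qq) => //; exists 0; rewrite !linear0.
  by apply: cval_inj; rewrite linear0.
- apply: (uqi_exact qq) => y; apply: csub0.
  by rewrite lt_eqF // /next /idx; lia.
Qed.
End StalkResolution.

Section AuslanderReiten.
Variables (R : pzRingType) (noeth : left_noetherian R).
Hypothesis gar : generalized_auslander_reiten R.

(* X is an extension of a perfect complex and a shift of a syzygy V of a
   resolution of X, so V inherits the vanishing of Ext(V, V) and Ext(V, R). *)
Lemma gar_perfect (X : bcomplex R) (N : nat) :
  (forall i, (N <= i)%N -> hom0 X (shiftn i X)) ->
  (forall i, (N <= i)%N -> hom0 X (shiftn i (stalk 0 (fin_gen_reg R)))) ->
  perfect X.
Proof.
move=> XX XR; have [Q [q [Qp Qf Qb qq]]] := resolution noeth X.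
have QR j : j <= - N%:Z - 1 -> coh0 Q R^o j.
  move=> jN; apply: nullh_stalk.
  have h : hom0 X (stalk (next j) (fin_gen_reg R)).
    have -> : next j = 0 - (absz (next j))%:Z by move: jN; rewrite /next; lia.
    apply: db_iso_hom0 (isomorphic_refl _) (shiftn_stalk _ _ _) (XR _ _).
    by move: jN; rewrite /next; lia.
  exact: (iffLR (hom0_nullh Qb Qf Qp _ qq) h).
have [kX XkX] := bc_zero_below X.
(* So [k = - c <= kX]. The lowest degree [k - 1] of [W] is written [Negz c] so that [idx 0] below
   reduces to it. *)
pose c := absz kX; pose k := next (Negz c).
have Xk : zero_below k (ubc X) by apply: XkX; rewrite /k /c /next; lia.
pose W := btrunc Qb Qf k.
have WX : db_iso X W.
  apply: isomorphic_sym; apply: (@db_iso_quasi_iso _ _ _ (bfactor Qb Qf Xk q)).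
  exact: (factor_uqi Xk qq).
have XW i : (N <= i)%N -> nullh Q (ubc (shiftn i W)).
  move=> iN; apply/(hom0_nullh Qb Qf Qp _ qq).
  exact: (db_iso_hom0 (isomorphic_refl _) (db_iso_shiftn i WX) (XX i iN)).
pose V : lmodType R := W (Negz c).
have [b Wb] := bc_bounded_above W.
pose j1 : int := - (N + c + absz b + absz k + 3)%N%:Z.
have QV j : j <= j1 -> coh0 Q V j.
  move=> jj1; pose i := absz (Negz c - next j)%R.
  have iE : i%:Z = Negz c - next j by move: jj1; rewrite /i /j1 /next; lia.
  have e : shiftn i W (next j) = V :> lmodType R.
    by rewrite shiftn_term iE addrC subrK.
  (* Shifted by [i], [W] has zero in degree [j], the syzygy [V] in degree [j + 1] and projective
     terms above; [j1] is low enough for [QR] to apply to each of the latter up to the top of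
     [W]. *)
  rewrite -e; apply: (@nullh_coh0 _ _ (ubc (shiftn i W))).
  - by apply: XW; move: jj1 iE; rewrite /j1 /next; lia.
  - rewrite /= shiftn_term => y; apply: (@trunc_low R Q k).
    by move: iE; rewrite /k /next; lia.
  - move=> n jn; rewrite /= shiftn_term; set m := (next (next n) + i%:Z).
    have [bm|mb] := ltP b m; first by apply: coh0_zero; apply: Wb.
    apply: coh0_projective; last apply: QR.
    + apply: projective_retract (Qp m); apply: (@trunc_retract R Q k).
      by move: jn iE; rewrite /m /k /next; lia.
    + exact: (@cx_fg R W).
    + by move: mb iE jj1; rewrite /m /j1 /next; lia.
pose idx (m : nat) := Negz (m + c).
have e m : next (idx m.+1) = idx m by rewrite /next /idx; lia.
have Qe m : exact_at Q (idx m.+1).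
  by apply: (uqi_exact qq); apply: Xk; rewrite /k /next /idx; lia.
pose aug : {linear Q (idx 0%N) -> V} := trunc_proj Q k (idx 0%N).
have [|||P [_ PQ]] := @nat_resolution R Q idx V e aug (fun m => Qp (idx m)).
- exact: (@trunc_proj_surj R Q k (idx 0%N)).
- move=> x; apply: iff_trans (cast_exact (e 0%N) erefl (Qe 0%N) x).
  split=> [/(congr1 trunc_val)|dx].
    by rewrite trunc_projE linear0 /trunc_fun lexx => -[].
  apply: trunc_val_inj; rewrite trunc_projE linear0 /trunc_fun.
  rewrite [ud _ _ _]dx if_same ifF //.
  by rewrite /k /idx /next; lia.
- by move=> m; apply: Qe.
have Vf : fin_gen V by apply: cx_fg.
have [|P' [n P'n]] := gar Vf.
  exists (absz j1).+2%:Z => -[|m] jm; first by lia.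
  have mj : idx m.+2 <= j1 by move: jm; rewrite /idx; lia.
  split=> P'; apply: (@ext_zero_any _ _ _ P); apply/PQ; first exact: QV.
  by apply: QR; move: mj; rewrite /j1; lia.
apply: (@coh0_perfect _ _ _ q (idx n.+2)) => // j U jn _.
(* This is Ext of [V] in degree [|j| - c - 2], which exceeds the length [n] of [P'], where every
   cochain is zero. *)
have -> : j = idx (absz j - c - 3).+2 by move: jn; rewrite /idx; lia.
apply/PQ; apply: (@ext_zero_any _ _ _ P') => f _; exists \0 => x /=.
by rewrite (P'n _ _ x) ?linear0 //; move: jn; rewrite /idx; lia.
Qed.
End AuslanderReiten.

(** One direction suffices, since a correspondence can be reversed by [cor_sym]. *)
Lemma cor_gar (R S : pzRingType) (rho : correspondence R S) :
  left_noetherian R -> left_noetherian S ->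
  generalized_auslander_reiten R -> generalized_auslander_reiten S.
Proof.
move=> noethR noethS gar M Mf [n0 ext0].
pose M0 := stalk 0 Mf.
have M0b n : 0 < n -> forall x : M0 n, x = 0.
  by move=> n0' x; apply: csub0; rewrite gt_eqF.
have [Q [q [Qp Qf Q0 qq]]] := resolution_exists noethS M0b.
have Qb : bounded_above Q by exists 0.
have [P [_ PQ]] := @stalk_nat_resolution S M Q q Qp Q0 qq.
pose j0 : int := - (absz n0 + 2)%N%:Z.
have QM j : j <= j0 -> coh0 Q M j /\ coh0 Q S^o j.
  move=> jj0; have -> : j = - (absz j - 2).+2%:Z by move: jj0; rewrite /j0; lia.
  have [|eM eS] := ext0 (absz j - 2).+1; first by move: jj0; rewrite /j0; lia.
  by split; apply/PQ; [apply: eM | apply: eS].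
have MM i : ((absz j0).+1 <= i)%N -> hom0 M0 (shiftn i M0).
  move=> ij; apply/(hom0_nullh Qb Qf Qp _ qq).
  have [k Mk] := bc_zero_below (shiftn i M0).
  apply: (@coh0_nullh _ _ _ k); first exact: Mk.
  move=> n; rewrite /= shiftn_term /=.
  have [e|ne] := EM (next n + i%:Z = 0); last first.
    by apply: coh0_zero => x; apply: csub0; apply/eqP.
  apply: coh0_retract (csub_retract _ _) _; apply: (QM _ _).1.
  by move: e; rewrite /next; lia.
have [X XM] := cor_r rho M0; have [T RT] := cor_l rho (stalk 0 (fin_gen_reg R)).
have Tp : perfect T := cor_perfect noethR noethS RT (perfect_reg R).
have [W [WT [N WN]]] := perfect_nullh noethS Tp (fun j h => (QM j h).2).
have Xp : perfect X.
  apply: (@gar_perfect R noethR gar X (N + (absz j0).+1)) => i iN.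
    by apply/(cor_hom0 XM (cor_shiftn i XM)); apply: MM; lia.
  apply/(cor_hom0 XM (cor_shiftn i RT)).
  apply: (db_iso_hom0 (isomorphic_refl _) (db_iso_shiftn i WT)).
  by apply/(hom0_nullh Qb Qf Qp _ qq); apply: WN; lia.
have Mp := cor_perfect noethR noethS XM Xp.
have [j1 Qj1] := perfect_coh0 Qp Qf Qb qq Mp.
have [k0 Mk0] := bc_zero_below M0.
(* As in [coh0_perfect], the truncation is projective in each degree and still resolves [M0]; being
   zero below [k - 1], it is the finite resolution sought. *)
pose j := Num.min j1 (k0 - 2); pose k := next (next j).
have Mk : zero_below k (ubc M0) by apply: Mk0; rewrite /k /j /next; lia.
have Wp : uprojective (trunc Q k).
  apply: trunc_projective => //; apply: Qj1; first by rewrite /j; lia.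
  exact: (@cx_fg S (btrunc Qb Qf k)).
have [n n_gt0 x||P' [P'0 _]] := @stalk_nat_resolution S M (trunc Q k) (factor Mk q) Wp.
- by have [y <-] := trunc_proj_surj x; rewrite (Q0 _ n_gt0 y) linear0.
- exact: (factor_uqi Mk qq).
exists P', (absz k).+1 => i ik; apply: P'0 => x.
by apply: (@trunc_low S Q k); move: ik; rewrite /next; lia.
Qed.

Theorem corollary3p6 (R S : pzRingType) (hR : left_noetherian R)
    (hS : left_noetherian S) (hRS : derived_equivalent R S) :
  generalized_auslander_reiten R <-> generalized_auslander_reiten S.
Proof.
have [rho] := derived_equivalent_cor hRS.
by split; [apply: (cor_gar rho) | apply: (cor_gar (cor_sym rho))].
Qed.
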